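(* Let $N=\binom n2$, let $0<p<1$ be a real (depending on $n$) and $0<m<2N$ an integer satisfying $m=2pN$ and $p\gg n^{-1/2}$. Let $X_n$ denote the number of directed Hamilton cycles in $\mathcal D(n,m)$ (or $\mathcal D(n,p)$). Let $\mu_n=\mathbf E_{\mathcal D(n,m)}X_n$ and $\lambda_n=\mathbf E_{\mathcal D(n,p)}X_n$. Then $X_n/\mu_n\xrightarrow{p}1$ in $\mathcal D(n,m)$. Assume further that $\limsup_{n\to\infty}p(n)<1$; then $$\frac{\ln\bigl(e^{\beta_n^2/2}X_n/\lambda_n\bigr)}{\beta_n}\xrightarrow{d}\mathcal N(0,1)\quad\text{in }\mathcal D(n,p),$$ where $\beta_n=\sqrt{(1-p)/p}$.
   Context: $\mathcal D(n,m)$ is the random digraph on vertex set $[n]$ whose $m$ directed edges are chosen uniformly at random from the $2N$ ordered pairs of distinct vertices; $\mathcal D(n,p)$ is the random digraph on $[n]$ including each possible directed edge independently with probability $p$. A directed Hamilton cycle is a directed cycle of length $n$ through all vertices. Limits are as $n\to\infty$; $a\gg b$ means $b=o(a)$. $\mathcal N(0,1)$ is the standard normal distribution; $\xrightarrow{p}$, $\xrightarrow{d}$ denote convergence in probability and in distribution. *)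

(* Defs.v *)
From HB Require Import structures.
From mathcomp Require Import all_boot all_order all_algebra.
From mathcomp Require Import all_classical all_reals all_analysis.

Set Implicit Arguments.
Unset Strict Implicit.
Unset Printing Implicit Defensive.

Import Order.TTheory GRing.Theory Num.Theory.
Import numFieldNormedType.Exports.

Local Open Scope ring_scope.

Definition darc (n : nat) : finType := {e : 'I_n * 'I_n | e.1 != e.2}.

Definition digraph (n : nat) : finType := {set darc n}.

(* [H] is the arc set of a directed cycle of length [n] through all vertices:
   [c] lists each vertex exactly once, and [next c x] is the cyclic successor
   of [x] in [c].  The same [H] arises from [n] rotations of [c], so counting
   the sets [H] (not the lists [c]) counts cycles as subgraphs. *)
Definition dhamcycle (n : nat) (H : digraph n) : bool :=
  [exists c : n.-tuple 'I_n,
    uniq c && (val @: H == [set (x, next c x) | x : 'I_n])].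

Definition num_dhamcycles (n : nat) (D : digraph n) : nat :=
  #|[set H : digraph n | (H \subset D) && dhamcycle H]|.

(* A probability on a finite type is given by its mass function [w]. *)
Definition Prob (R : realType) (T : finType) (w : T -> R) (A : pred T) : R :=
  \sum_(t | A t) w t.

Definition Expect (R : realType) (T : finType) (w : T -> R) (X : T -> R) : R :=
  \sum_t w t * X t.

Definition Dnm (R : realType) (n m : nat) (D : digraph n) : R :=
  if #|D| == m then (#|[set D' : digraph n | #|D'| == m]|%:R)^-1 else 0.

Definition Dnp (R : realType) (n : nat) (p : R) (D : digraph n) : R :=
  \prod_(e : darc n) (if e \in D then p else 1 - p).

Arguments Dnm R n m D : clear implicits.
Arguments Dnp {R} n p D.

Local Open Scope classical_set_scope.

Definition cvg_in_prob (R : realType) (T : nat -> finType)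
    (w : forall n, T n -> R) (X : forall n, T n -> R) (c : R) : Prop :=
  forall eps : R, 0 < eps ->
    (fun n => Prob (w n) (fun t => eps < `|X n t - c|)) @ \oo --> (0 : R).

(* Convergence of distribution functions at the continuity points of that of
   the limit law [nu] on the reals.  The variables may take infinite values,
   which is needed for the logarithm of a count that vanishes with positive
   probability. *)
Definition cvg_in_dist (R : realType) (T : nat -> finType)
    (w : forall n, T n -> R) (Y : forall n, T n -> \bar R)
    (nu : probability (measurableTypeR R) R) : Prop :=
  let F (x : R) : R := fine (nu `]-oo, x]%classic) in
  forall x : R, {for x, continuous F} ->
    (fun n => Prob (w n) (fun t => (Y n t <= x%:E)%E)) @ \oo --> F x.

(* Main.v *)
Require Import Defs.
From HB Require Import structures.
From mathcomp Require Import all_boot all_order all_algebra.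
From mathcomp Require Import all_classical all_reals all_analysis.
From mathcomp Require Import measurable_realfun zify ring lra.

(** The law of the number [X] of directed Hamilton cycles is governed by the
number of arcs, and given that number [X] is concentrated.

Concentration is a second moment argument.  Let [M = n(n-1)] be the number of
possible arcs.  When [m] arcs are chosen, a given set of [a] arcs is present
with probability [m(m-1)...(m-a+1) / M(M-1)...(M-a+1)] ([ffratio]).  The second
moment of [X] over its squared mean is therefore an average, over pairs of
Hamilton cycles, of a function of the size [k] of their intersection, and this
function is at most [(1-d)^n z^k] where [z-1] and [dn] are both close to
[M/m - 1] ([ffratio_overlap]).  The overlap of two cycles is nearly Poisson with
mean 1: among at least [(n-1)!] cycles, at most [(n-1-j)!] pass through [j]
given arcs of one cycle ([card_dhamcycle_supset]), and binomial moments give an average of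
[z^k] of at most about [exp(z-1)] ([overlap_sum_le]).  The factors
[exp(z-1)] and [(1-d)^n] cancel up to [exp O(n^3/m^2)], and [n^3/m^2] is of
order [1/(n p^2)], which tends to zero exactly when [p] is much larger than
[n^(-1/2)].  Chebyshev's inequality then yields [concentration], with a bound
that is uniform in [m].

When arcs are independent, the digraph given that it has [k] arcs is uniform
([Prob_mixture]), so [X] is close to its conditional mean, whose ratio to
the mean of [X] is [ffratio M k n / p^n].  Expanding logarithms, with [t] the
standardised value of [k], this ratio is [exp(beta t - beta^2/2 + O(1/(n p^2)))]
([ln_ffratio], [log_mean_numeric]); the term [n ln(k/(pM))] gives [beta t], and
the correction for sampling without replacement gives [-beta^2/2].  Since
[beta] stays away from zero when [limsup p < 1], dividing by [beta] keeps the
errors small, and the normalised logarithm differs from [t] by a vanishing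
amount ([logcount_approx]).  The limit law is thus that of [t], the standardised
binomial number of arcs, and the central limit theorem for it ([binomial_clt])
is proved by comparing binomial weights with Gaussian masses of cells: the
ratio of the two varies little between neighbouring cells ([logdens_step]),
hence is nearly constant over a wide window, and the constant is nearly 1 because
both measures put nearly all their mass there. *)

Set Implicit Arguments.
Unset Strict Implicit.
Unset Printing Implicit Defensive.

Import Order.TTheory GRing.Theory Num.Theory.
Import numFieldNormedType.Exports.

Local Open Scope ring_scope.

(** * Rooted listings of Hamilton cycles and counting through given arcs *)

(** Reinsertion principle: [A] holds at the tails of prescribed arcs [(x, g x)] and
[T] at their heads.  In a path that follows every prescribed arc and enters [T]
in no other way, an element of [T] can stand only right after its
prescribed predecessor, so erasing [T] loses no information. *)
Lemma path_filter_inj (V : eqType) (A T : pred V) (g : V -> V)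
    (w : V) (s s' : seq V) :
  let e x y := if A x then (y == g x) && T y else ~~ T y in
  path e w s -> path e w s' -> ~~ A (last w s) -> ~~ A (last w s') ->
  [seq x <- s | ~~ T x] = [seq x <- s' | ~~ T x] -> s = s'.
Proof.
move=> e; elim: s w s' => [|y s IHs] w [|y' s'] //=.
- move=> _ /andP[+ _] Aw _; rewrite /e (negbTE Aw) => -> //.
- move=> /andP[+ _] _ _ Aw; rewrite /e (negbTE Aw) => -> //.
rewrite {1 3}/e; case: ifP => Aw.
  move=> /andP[/andP[/eqP-> Ty] ps] /andP[/andP[/eqP-> _] ps'] ls ls'.
  by rewrite Ty /= => eq_s; rewrite (IHs _ _ ps ps').
move=> /andP[Ty ps] /andP[Ty' ps'] ls ls'; rewrite Ty Ty' => -[eq_y eq_s].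
by rewrite -eq_y in ps' ls' *; rewrite (IHs _ _ ps ps').
Qed.

Section HamCycles.
Variable n : nat.
Implicit Types (H S : digraph n) (v : 'I_n) (s : seq 'I_n).

(** [s] lists, from the successor of [v] on, the vertices of the cycle [H].  Fixing
the starting vertex removes the ambiguity of the [n] rotations. *)
Definition rooted_at v H s :=
  [&& size s == n.-1, uniq (v :: s) &
      val @: H == [set (x, next (v :: s) x) | x : 'I_n]].

Lemma rooted_exists v H : dhamcycle H -> exists s, rooted_at v H s.
Proof.
case/existsP=> c /andP[Uc /eqP Hc].
have vc : v \in c.
  have /subset_leq_card/= := fintype.subset_predT (mem c).
  have : size c = #|'I_n| by rewrite size_tuple card_ord.
  rewrite -(card_uniqP Uc) => cc _.
  by have /subset_cardP/(_ (fintype.subset_predT _)) -> := cc.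
case/rot_to: vc => i s Es; exists s; apply/and3P; split.
- have : size (rot i c) = n by rewrite size_rot size_tuple.
  by rewrite Es /= => sn; rewrite -[X in _ == X.-1]sn.
- by rewrite -Es rot_uniq.
- apply/eqP; rewrite Hc; apply: eq_imset => x.
  by rewrite -Es next_rot.
Qed.

Lemma rooted_mem v H s (e : darc n) : rooted_at v H s ->
  (e \in H) = ((val e).2 == next (v :: s) (val e).1).
Proof.
move=> /and3P[_ _ /eqP Hs].
rewrite -(mem_imset _ _ val_inj) Hs; apply/imsetP/eqP => [[x _ ->]//|E].
by exists (val e).1 => //; rewrite -E -surjective_pairing.
Qed.

Lemma rooted_arc v H s x : rooted_at v H s ->
  exists2 e : darc n, e \in H & val e = (x, next (v :: s) x).
Proof.
move=> /and3P[_ _ /eqP Hs].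
have: (x, next (v :: s) x) \in val @: H by rewrite Hs imset_f.
by case/imsetP=> e eH Ee; exists e.
Qed.

Lemma card_dhamcycle H : dhamcycle H -> #|H| = n.
Proof.
move=> hH; case/existsP: (hH) => c /andP[_ /eqP Hc].
by rewrite -(card_imset _ val_inj) Hc card_imset ?card_ord // => x y [].
Qed.

Lemma rooted_path v H s : rooted_at v H s ->
  path (frel (next (v :: s))) v s /\ next (v :: s) (last v s) = v.
Proof.
move=> /and3P[_ Us _].
by have := cycle_next Us; rewrite /= rcons_path => /andP[? /eqP].
Qed.

Lemma next_neq v s x : uniq (v :: s) -> (0 < size s)%N -> x \in v :: s ->
  next (v :: s) x != x.
Proof.
move=> Us s0 /rot_to[i [|y q] Es].
  have : size (rot i (v :: s)) = 1%N by rewrite Es.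
  by rewrite size_rot /= => -[] E; rewrite E in s0.
rewrite -(next_rot i Us) Es /= eqxx.
move: Us; rewrite -(rot_uniq i) Es /= inE => /andP[/norP[+ _] _].
by rewrite eq_sym.
Qed.

(** Distinct listings of the vertices other than [v] give distinct cycles, because
the successor function of a cycle determines its listing from [v]. *)
Lemma card_dhamcycle_ge : (1 < n)%N ->
  (n.-1`! <= #|[set H : digraph n | dhamcycle H]|)%N.
Proof.
move=> n1; have v : 'I_n by exists 0%N; exact: ltnW.
pose B : pred 'I_n := [pred x | x != v].
have cB : #|B| = n.-1 by rewrite cardC1 card_ord.
pose U := [set t : n.-1.-tuple 'I_n | all B t & uniq t].
pose f (t : n.-1.-tuple 'I_n) : digraph n :=
  [set e : darc n | (val e).2 == next (v :: t) (val e).1].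
have Uuniq t : t \in U -> uniq (v :: t).
  rewrite inE => /andP[/allP Bt ut] /=; rewrite ut andbT.
  by apply/negP => /Bt; rewrite /B /= eqxx.
have Ufull t x : t \in U -> x \in v :: t.
  move=> /Uuniq Ut; have cc : #|v :: t| = #|'I_n|.
    by rewrite (card_uniqP Ut) /= size_tuple card_ord prednK // ltnW.
  by have /subset_cardP/(_ (fintype.subset_predT _)) -> := cc.
have fr t : t \in U -> rooted_at v (f t) t.
  move=> tU; apply/and3P; split; [by rewrite size_tuple|exact: Uuniq|].
  apply/eqP/setP => -[x y]; apply/imsetP/imsetP => [[e]|[z _]].
    by rewrite inE => /eqP E ->; exists (val e).1 => //; rewrite -E; case: (val e).
  move=> [-> ->]; have zn : z != next (v :: t) z.
    rewrite eq_sym next_neq ?Uuniq ?Ufull // size_tuple.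
    by rewrite -ltnS prednK // ltnW.
  by exists (exist _ (z, next (v :: t) z) zn); rewrite // inE.
have finj : {in U &, injective f}.
  move=> t t' tU tU' eqf.
  have [p _] := rooted_path (fr _ tU); have [p' _] := rooted_path (fr _ tU').
  have Et := fpathE p; have Et' := fpathE p'.
  have eqn : next (v :: t) =1 next (v :: t').
    move=> x; have [e eH Ee] := rooted_arc x (fr _ tU).
    move: eH; rewrite eqf inE Ee /= => /eqP ->//.
  apply/val_inj; rewrite /= Et Et' !size_tuple eqn.
  have eq_traj (h h' : 'I_n -> 'I_n) k : h =1 h' -> forall x, traject h x k = traject h' x k.
    by move=> hh; elim: k => //= k IHk x; rewrite hh IHk.
  exact: eq_traj.
have -> : n.-1`! = #|f @: U|.
  by rewrite card_in_imset // card_uniq_tuples cB ffactnn.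
apply: subset_leq_card; apply/fintype.subsetP => _ /imsetP[t tU ->].
rewrite inE; apply/existsP.
have sz : size (v :: t) == n by rewrite /= size_tuple prednK // ltnW.
exists (Tuple sz) => /=; case/and3P: (fr _ tU) => _ /= -> /eqP ->.
by rewrite eqxx.
Qed.

(** If [S] has [j < n] arcs, their heads are distinct, so some vertex [v] is not among them.
List each cycle from [v] and erase these heads: by [path_filter_inj] the
result determines the cycle, and it arranges the remaining [n-1-j] vertices.
When [S] is all of [H0] the truncated difference gives the bound [0! = 1]. *)
Lemma card_dhamcycle_supset H0 S : dhamcycle H0 -> S \subset H0 ->
  (#|[set H : digraph n | dhamcycle H & S \subset H]| <= (n.-1 - #|S|)`!)%N.
Proof.
move=> hH0 SH0.
have [nS|Sn] := leqP n #|S|.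
  have -> : S = H0 by apply/eqP; rewrite eqEcard SH0 card_dhamcycle.
  (* Cycles all have [n] arcs, so only [H0] itself contains [H0]. *)
  apply: leq_trans (fact_gt0 _); rewrite -(cards1 H0); apply: subset_leq_card.
  apply/fintype.subsetP => H; rewrite !inE => /andP[hH HH].
  by rewrite eq_sym eqEcard HH !card_dhamcycle // leqnn.
have u : 'I_n by exists 0%N; apply: leq_ltn_trans Sn.
have [s0 r0] := rooted_exists u hH0; set g := next (u :: s0).
have uniq0 : uniq (u :: s0) by case/and3P: r0.
have ginj : injective g by exact: can_inj (prev_next uniq0).
have Sg e : e \in S -> (val e).2 = g (val e).1.
  by move=> /(fintype.subsetP SH0); rewrite (rooted_mem _ r0) => /eqP.
pose A := [set (val e).1 | e in S]; pose T := [set (val e).2 | e in S].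
have cT : #|T| = #|S|.
  apply: card_in_imset => e e' eS eS' E; apply: val_inj.
  have E1 : (val e).1 = (val e').1 by apply: ginj; rewrite -!Sg.
  by move: E E1; case: (val e) (val e') => [? ?] [? ?] /= -> ->.
have [v vT] : exists v, v \notin T.
  apply/existsP; apply: contraTT Sn; rewrite negb_exists => /forallP aT.
  rewrite -leqNgt -cT -[X in (X <= _)%N]card_ord.
  apply: subset_leq_card; apply/fintype.subsetP => x _.
  by have := aT x; rewrite negbK.
pose k := (n.-1 - #|S|)%N.
pose B : pred 'I_n := [pred x | x \notin v |: T].
have cB : #|B| = k.
  rewrite [LHS](_ : _ = #|~: (v |: T)|); last first.
    by apply: eq_card => x; rewrite !inE.
  by rewrite cardsCs finset.setCK cardsU1 vT cT card_ord /k /= subnDA subn1.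
pose rt H : seq 'I_n := odflt [::] (omap val [pick s : n.-1.-tuple 'I_n | rooted_at v H s]).
have rtP H : dhamcycle H -> rooted_at v H (rt H).
  move=> /(rooted_exists v)[s rs]; rewrite /rt; case: pickP => //= no.
  have sz : size s == n.-1 by case/and3P: rs.
  by have := no (Tuple sz); rewrite /= rs.
pose F := [set H : digraph n | dhamcycle H & S \subset H].
pose red H := [seq x <- rt H | x \notin T].
have step H : H \in F ->
    (forall x, x \in A -> next (v :: rt H) x = g x /\ g x \in T) /\
    (forall x, x \notin A -> next (v :: rt H) x \notin T).
  rewrite inE => /andP[/rtP rH SH]; have Hs := rooted_mem _ rH.
  have Sn' e : e \in S -> (val e).2 = next (v :: rt H) (val e).1.
    by move=> /(fintype.subsetP SH); rewrite Hs => /eqP.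
  split=> [x /imsetP[e eS ->]|x xA].
    by rewrite -Sn' // -Sg //; split=> //; apply/imsetP; exists e.
  apply/imsetP => -[e eS]; rewrite (Sn' e eS) => E.
  have uH : uniq (v :: rt H) by case/and3P: rH.
  by case/negP: xA; rewrite (can_inj (prev_next uH) E); apply/imsetP; exists e.
have Fpath H : H \in F ->
    path (fun x y => if x \in A then (y == g x) && (y \in T) else y \notin T) v (rt H)
    /\ last v (rt H) \notin A.
  move=> HF; have [st1 st2] := step H HF.
  have [pH lH] : path (frel (next (v :: rt H))) v (rt H) /\ next (v :: rt H) (last v (rt H)) = v.
    by apply: rooted_path; apply: rtP; move: HF; rewrite inE => /andP[].
  split.
    apply: sub_path pH => x y /eqP Exy.
    have {Exy}<- : next (v :: rt H) x = y := Exy.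
    case: ifP => xA.
      by have [-> ->] := st1 x xA; rewrite eqxx.
    by apply: st2; rewrite xA.
  by apply: contra vT => /st1[E gT]; rewrite -lH E.
have redinj : {in F &, injective red}.
  move=> H H' HF HF' eqr.
  have [pH lH] := Fpath H HF; have [pH' lH'] := Fpath H' HF'.
  have Ert := @path_filter_inj _ (mem A) (mem T) g v _ _ pH pH' lH lH' eqr.
  move: HF HF'; rewrite !inE => /andP[/rtP rH _] /andP[/rtP rH' _].
  by apply/setP => e; rewrite (rooted_mem _ rH) (rooted_mem _ rH') Ert.
have redP H : H \in F -> [/\ size (red H) = k, all B (red H) & uniq (red H)].
  move=> HF; have := HF; rewrite inE => /andP[/rtP rH SH].
  case/and3P: rH => /eqP sH /= /andP[vH uH] _.
  have ur : uniq (red H) by rewrite filter_uniq.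
  have aB : all B (red H).
    apply/allP => x; rewrite mem_filter => /andP[xT xH].
    rewrite /B /= !inE negb_or xT andbT.
    by apply: contraNneq vH => <-.
  split=> //; rewrite -cB; have /card_uniqP <- := ur.
  apply: eq_card => x; apply/idP/idP => [/(allP aB)//|].
  rewrite !inE negb_or mem_filter => /andP[xv xT]; rewrite xT /=.
  have cc : #|v :: rt H| = #|'I_n|.
    rewrite (card_uniqP _) /= ?vH // sH card_ord prednK //.
    by apply: leq_ltn_trans Sn.
  have /subset_cardP/(_ (fintype.subset_predT _) x) := cc.
  by rewrite !inE (negbTE xv).
pose t0 : k.-tuple 'I_n := [tuple of nseq k v].
pose f H : k.-tuple 'I_n := insubd t0 (red H).
have fE H : H \in F -> val (f H) = red H.
  by move=> /redP[sH _ _]; rewrite /f insubdK // -topredE /= sH.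
have finj : {in F &, injective f}.
  by move=> H H' HF HF' E; apply: redinj => //; rewrite -!fE // E.
have cU : #|[set t : k.-tuple 'I_n | all B t & uniq t]| = k`!.
  by rewrite card_uniq_tuples cB ffactnn.
rewrite -/F -(card_in_imset finj) -/k -cU.
apply: subset_leq_card; apply/fintype.subsetP => _ /imsetP[H HF ->].
by have [_ aB uB] := redP H HF; rewrite inE fE // aB uB.
Qed.

End HamCycles.

(** * Random digraphs: inclusion probabilities, mixtures, Chebyshev *)

Lemma card_darc n : #|darc n| = (n * n.-1)%N.
Proof.
rewrite card_sig.
have := cardC [pred e : 'I_n * 'I_n | e.1 == e.2].
rewrite card_prod card_ord.
have -> : #|[pred e : 'I_n * 'I_n | e.1 == e.2]| = n.
  rewrite -[RHS]card_ord -(card_imset (f := fun x : 'I_n => (x, x))) //.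
    apply: eq_card => -[x y]; apply/eqP/imsetP => /= [->|[z _ [-> ->]]] //.
    by exists y.
  by move=> x y [].
case: n => [|n]; first by move=> _; apply: eq_card0 => -[[]].
move=> E; apply/eqP; rewrite -(eqn_add2l n.+1) -[X in _ == X]mulnS.
by rewrite prednK // -E; apply/eqP; congr addn; apply: eq_card => e; rewrite !inE.
Qed.

(** The probability that [a] given elements belong to a uniform [m]-subset of a set
of size [M]; see [superset_prob_Dnm]. *)
Definition ffratio (R : realType) (M m a : nat) : R :=
  \prod_(i < a) ((m%:R - i%:R) / (M%:R - i%:R)).

(** Both sides gain the factor [(m-a)/(M-a)] when [a] increases; for [a > m]
both vanish. *)
Lemma ffratioE (R : realType) (M m a : nat) : (m <= M)%N -> (a <= M)%N ->
  ('C(M - a, M - m))%:R / ('C(M, m))%:R = ffratio R M m a.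
Proof.
move=> mM; have C0 : ('C(M, m))%:R != 0 :> R by rewrite pnatr_eq0 -lt0n bin_gt0.
elim: a => [|a IHa] aM; first by rewrite subn0 bin_sub // /ffratio big_ord0 divff.
rewrite /ffratio big_ord_recr /= -/(ffratio R M m a) -IHa ?(ltnW aM) //.
have Ma0 : M%:R - a%:R != 0 :> R by rewrite subr_eq0 eqr_nat gtn_eqF.
have := mul_bin_down (M - a) (M - m); rewrite -subnS.
case: (leqP a m) => am.
  rewrite subnAC subKn // => /(congr1 (fun k : nat => k%:R : R)).
  rewrite !natrM !natrB // ?(ltnW aM) // => E.
  by apply: (mulfI Ma0); rewrite [LHS]mulrA E; field; apply/andP.
have lt : (M - a < M - m)%N by rewrite ltn_sub2l // (leq_ltn_trans _ aM) // ltnW.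
rewrite (@bin_small (M - a)) // muln0 mul0r mul0r (@bin_small (M - a.+1)) ?mul0r //.
by apply: leq_ltn_trans lt; rewrite leq_sub2l.
Qed.

Section Weights.
Variables (R : realType) (n : nat).
Implicit Types (w : digraph n -> R) (A D H : digraph n).

Definition superset_prob w A : R := \sum_(D : digraph n | A \subset D) w D.

Lemma superset_probE w A : superset_prob w A = \sum_D w D * (A \subset D)%:R.
Proof.
rewrite /superset_prob big_mkcond; apply: eq_bigr => D _.
by case: ifP; rewrite ?mulr1 ?mulr0.
Qed.

Lemma num_dhamcyclesE D :
  (num_dhamcycles D)%:R = \sum_(H | dhamcycle H) (H \subset D)%:R :> R.
Proof.
rewrite /num_dhamcycles cardsE -sum1_card natr_sum [LHS]big_mkcond [RHS]big_mkcond.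
apply: eq_bigr => H _; rewrite unfold_in /=.
by case: (H \subset D); case: (dhamcycle H).
Qed.

Lemma Expect_num_dhamcycles w :
  Expect w (fun D => (num_dhamcycles D)%:R) = \sum_(H | dhamcycle H) superset_prob w H.
Proof.
rewrite /Expect; under eq_bigr do rewrite num_dhamcyclesE big_distrr /=.
by rewrite exchange_big; apply: eq_bigr => H _; rewrite superset_probE.
Qed.

Lemma Expect_num_dhamcycles_sqr w :
  Expect w (fun D => (num_dhamcycles D)%:R ^+ 2) =
  \sum_(H | dhamcycle H) \sum_(H' | dhamcycle H') superset_prob w (H :|: H').
Proof.
rewrite /Expect.
under eq_bigr do rewrite num_dhamcyclesE expr2 big_distrl /= big_distrr /=.
rewrite exchange_big; apply: eq_bigr => H _.
under eq_bigr do rewrite big_distrr /= big_distrr /=.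
rewrite exchange_big; apply: eq_bigr => H' _.
by rewrite superset_probE; apply: eq_bigr => D _; rewrite finset.subUset -natrM mulnb.
Qed.

(** Complements turn the supersets of [A] of size [m] into the subsets of [~: A] of
size [M - m]. *)
Lemma superset_prob_Dnm m A : (m <= #|darc n|)%N ->
  superset_prob (Dnm R n m) A = ffratio R #|darc n| m #|A|.
Proof.
move=> mM; rewrite -ffratioE ?max_card //.
rewrite /superset_prob /Dnm -big_mkcondr /=.
rewrite (eq_bigl (fun D => D \in [set D : digraph n | (A \subset D) && (#|D| == m)])); last first.
  by move=> D; rewrite inE.
rewrite sumr_const -[LHS]mulr_natl card_draws; congr (_%:R * _).
have -> : (#|darc n| - #|A|)%N = #|~: A| by rewrite [RHS]cardsCs finset.setCK.
rewrite -cards_draws -[RHS](card_imset _ (inv_inj (@finset.setCK _))).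
apply: eq_card => D; rewrite inE; apply/esym.
apply/imsetP/andP => [[D' + ->]|[DA /eqP cD]].
  rewrite inE => /andP[AD /eqP cD].
  by rewrite -finset.setCS finset.setCK AD cardsCs finset.setCK cD subKn.
exists (~: D); last by rewrite finset.setCK.
by rewrite inE finset.setCS DA cardsCs finset.setCK cD eqxx.
Qed.

Lemma superset_prob_Dnp p A : superset_prob (Dnp n p) A = p ^+ #|A|.
Proof.
rewrite superset_probE.
transitivity (\prod_(e : darc n) (p + (if e \in A then 0 else 1 - p))).
  rewrite bigA_distr; apply: eq_bigr => D _; rewrite /Dnp.
  case: (boolP (A \subset D)) => [/fintype.subsetP AD|/fintype.subsetPn[e eA eD]].
    rewrite mulr1; apply: eq_bigr => e _; case: ifP => // eD.
    by case: ifP => // /AD; rewrite eD.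
  by rewrite mulr0 [RHS](bigD1 e) //= (negbTE eD) eA mul0r.
rewrite (bigID (mem A)) /= [X in _ * X]big1 ?mulr1; last by move=> e /negbTE ->; ring.
rewrite (eq_bigr (fun=> p)) => [|e ->]; last by rewrite addr0.
by rewrite prodr_const.
Qed.

Lemma DnpE (p : R) D : Dnp n p D = p ^+ #|D| * (1 - p) ^+ (#|darc n| - #|D|).
Proof.
rewrite /Dnp (bigID (mem D)) /= (eq_bigr (fun=> p)); last by move=> e ->.
rewrite prodr_const; congr (_ * _).
rewrite (eq_bigr (fun=> 1 - p)); last by move=> e /negbTE ->.
rewrite (eq_bigl (fun e => e \in ~: D)); last by move=> e; rewrite !inE.
by rewrite prodr_const cardsCs finset.setCK.
Qed.

End Weights.

Definition binw (R : realType) (M : nat) (p : R) (k : nat) : R :=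
  'C(M, k)%:R * p ^+ k * (1 - p) ^+ (M - k).

Section Mixture.
Variables (R : realType) (n : nat).

Lemma Dnm_ge0 m D : 0 <= Dnm R n m D.
Proof. by rewrite /Dnm; case: ifP => // _; rewrite invr_ge0. Qed.

Lemma Dnm_sum1 m : (m <= #|darc n|)%N -> \sum_D Dnm R n m D = 1.
Proof.
move=> mM; have := @superset_prob_Dnm R n m finset.set0 mM.
rewrite cards0 /ffratio big_ord0 => <-; apply: eq_bigl => D.
by rewrite finset.sub0set.
Qed.

(** Given its number of arcs, a digraph with independent arcs is uniform. *)
Lemma Dnp_mixture (p : R) (D : digraph n) :
  Dnp n p D = \sum_(k < #|darc n|.+1) binw #|darc n| p k * Dnm R n k D.
Proof.
have cD : (#|D| < #|darc n|.+1)%N by rewrite ltnS max_card.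
rewrite (bigD1 (Ordinal cD)) //= [X in _ + X](_ : _ = 0) ?addr0; last first.
  by apply: big1 => k kD; rewrite /Dnm eq_sym ifN ?mulr0.
rewrite DnpE /Dnm ifT; last exact: eqxx.
rewrite card_draws /binw.
set C := 'C(_, _)%:R; set r := p ^+ _; set q := (1 - p) ^+ _.
have C0 : C != 0 by rewrite pnatr_eq0 -lt0n bin_gt0 max_card.
rewrite -[LHS]mul1r -(divff C0) mulrA -!mulrA; congr (_ * _).
by rewrite mulrC mulrA.
Qed.

Lemma Prob_mixture (p : R) (E : pred (digraph n)) :
  Prob (Dnp n p) E =
  \sum_(k < #|darc n|.+1) binw #|darc n| p k * Prob (Dnm R n k) E.
Proof.
rewrite /Prob; under eq_bigr do rewrite Dnp_mixture.
by rewrite exchange_big; apply: eq_bigr => k _; rewrite big_distrr.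
Qed.

End Mixture.

Section FiniteProb.
Variables (R : realType) (T : finType) (w : T -> R).
Hypotheses (w0 : forall t, 0 <= w t) (w1 : \sum_t w t = 1).

Lemma Prob_ge0 (A : pred T) : 0 <= Prob w A.
Proof. exact: sumr_ge0. Qed.

Lemma Prob_mono (A B : pred T) : {subset A <= B} -> Prob w A <= Prob w B.
Proof.
move=> AB; rewrite /Prob (big_mkcond A) (big_mkcond B) /=.
apply: ler_sum => t _; case: ifP => // At; first by rewrite ifT //; exact: AB.
by case: ifP.
Qed.

Lemma Prob_le1 A : Prob w A <= 1.
Proof. by rewrite -w1; apply: (@Prob_mono A predT) => t. Qed.

Lemma chebyshev_ratio (X : T -> R) (mu eps : R) :
  mu = Expect w X -> 0 < mu -> 0 < eps ->
  Prob w (fun t => eps < `|X t / mu - 1|) <=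
  (Expect w (fun t => X t ^+ 2) / mu ^+ 2 - 1) / eps ^+ 2.
Proof.
move=> muE mu0 e0; have mun0 : mu != 0 by rewrite gt_eqF.
have -> : Expect w (fun t => X t ^+ 2) / mu ^+ 2 - 1
    = \sum_t w t * (X t / mu - 1) ^+ 2.
  transitivity ((\sum_t w t * X t ^+ 2) / mu ^+ 2 - 2 / mu * (\sum_t w t * X t) + \sum_t w t).
    by rewrite w1 /Expect -[X in _ = _ - _ * X + _]muE; field.
  rewrite mulr_suml mulr_sumr -sumrB -big_split /=; apply: eq_bigr => t _.
  by field.
rewrite ler_pdivlMr ?exprn_gt0 // /Prob mulr_suml big_mkcond /=.
apply: ler_sum => t _; case: ifP => [lt|_]; last by rewrite mulr_ge0 // sqr_ge0.
rewrite ler_wpM2l // -[leRHS]real_normK ?num_real //.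
by rewrite lerXn2r ?nnegrE // ltW.
Qed.

End FiniteProb.

(** * Exponential moment of the overlap of two Hamilton cycles *)

(** Turns an exponential moment into binomial moments. *)
Lemma sum_subset_expr (R : realType) (T : finType) (u : R) (A : {set T}) :
  \sum_(S : {set T} | S \subset A) u ^+ #|S| = (1 + u) ^+ #|A|.
Proof.
rewrite addrC -prodr_const big_mkcond /=.
transitivity (\prod_(e : T) ((if e \in A then u else 0) + 1)); last first.
  by rewrite [RHS]big_mkcond; apply: eq_bigr => e _; case: ifP => //; rewrite add0r.
rewrite bigA_distr; apply: eq_bigr => S _.
case: ifP => [/fintype.subsetP SA|/negbT/fintype.subsetPn[e eS /negbTE eA]].
  rewrite -prodr_const big_mkcond; apply: eq_bigr => e _.
  by case: ifP => // /SA ->.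
by rewrite (bigD1 e) //= eS eA mul0r.
Qed.

Lemma sum_subset_card (R : realType) (T : finType) (f : nat -> R) (A : {set T}) :
  \sum_(S : {set T} | S \subset A) f #|S| =
  \sum_(j < #|A|.+1) 'C(#|A|, j)%:R * f j.
Proof.
have cS (S : {set T}) : S \subset A -> (#|S| < #|A|.+1)%N.
  by move=> SA; rewrite ltnS subset_leq_card.
rewrite (partition_big (fun S : {set T} => inord #|S| : 'I_#|A|.+1) predT) //=.
apply: eq_bigr => j _; rewrite -cards_draws mulr_natl -sumr_const.
apply: eq_big => S; first by rewrite inE; case: (boolP (S \subset A)) => //= SA;
   rewrite -val_eqE /= inordK ?cS.
by move=> /andP[SA /eqP <-]; rewrite inordK // cS.
Qed.

Section ExpSums.
Variable R : realType.
Implicit Types (u : R) (n : nat).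

Lemma exp_partial_le u n : 0 <= u -> \sum_(j < n) u ^+ j / j`!%:R <= expR u.
Proof.
move=> u0.
have nd : nondecreasing_seq (series (exp_coeff u)).
  apply/nondecreasing_seqP => k; rewrite /series /= !big_mkord big_ord_recr /=.
  by rewrite lerDl /exp_coeff /= divr_ge0 ?exprn_ge0.
have := nondecreasing_cvgn_le nd (is_cvg_series_exp_coeff u) n.
by rewrite {1}/series /= big_mkord.
Qed.

(** Since [j(j+1) = j(j-1) + 2j], the correction is a combination of the
first two factorial moments of the exponential series. *)
Lemma exp_moment_le u n N : 0 <= u -> (0 < N)%N ->
  \sum_(j < n) u ^+ j / j`!%:R * (1 + (j * j.+1)%:R / N%:R) <=
  expR u * (1 + (u ^+ 2 + 2 * u) / N%:R).
Proof.
move=> u0 N0.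
have N0' : (0 : R) < N%:R by rewrite ltr0n.
have shift k : \sum_(j < n) u ^+ j / j`!%:R * (j ^_ k)%:R <= u ^+ k * expR u.
  elim: k n => [|k IHk] n'.
    rewrite mul1r; apply: le_trans (exp_partial_le n' u0).
    by apply: ler_sum => j _; rewrite ffactn0 mulr1.
  case: n' => [|n']; first by rewrite big_ord0 mulr_ge0 ?exprn_ge0 ?expR_ge0.
  rewrite big_ord_recl ffact0n mulr0 add0r exprS -mulrA.
  apply: le_trans (ler_wpM2l u0 (IHk n')); rewrite mulr_sumr.
  apply: ler_sum => j _; rewrite /= /bump /= add1n factS ffactSS !natrM exprS.
  rewrite le_eqVlt; apply/orP; left; apply/eqP; field.
  by rewrite nat1r !pnatr_eq0 -!lt0n fact_gt0.
have -> : expR u * (1 + (u ^+ 2 + 2 * u) / N%:R) =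
   u ^+ 0 * expR u + N%:R^-1 * (u ^+ 2 * expR u) + 2 / N%:R * (u ^+ 1 * expR u).
  by field; rewrite gt_eqF.
apply: le_trans (lerD (lerD (shift 0%N) (ler_wpM2l _ (shift 2%N))) (ler_wpM2l _ (shift 1%N))).
- rewrite !mulr_sumr -!big_split /=; apply: ler_sum => j _.
  rewrite le_eqVlt; apply/orP; left; apply/eqP.
  have -> : (j * j.+1)%:R = (j ^_ 2)%:R + 2 * (j ^_ 1)%:R :> R.
    rewrite -natrM -natrD; congr _%:R; rewrite ffactn1; case: (val j) => [|k] //.
    by rewrite ffactSS ffactn1; lia.
  rewrite ffactn0; field.
  by rewrite !gt_eqF ?ltr0n ?fact_gt0.
- by rewrite invr_ge0 ltW.
- by rewrite divr_ge0 ?ltW.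
Qed.

(** For [j < n] the left side over [(n-1)!] is [n/(n-j)] divided by [j!], and
[n/(n-j) <= 1 + j(j+1)/n].  For [j = n] the truncated difference makes the second
factor [0! = 1]. *)
Lemma bin_mul_fact_le n j : (0 < n)%N -> (j <= n)%N ->
  'C(n, j)%:R * ((n.-1 - j)`!)%:R <=
  (n.-1)`!%:R * ((j`!%:R)^-1 * (1 + (j * j.+1)%:R / n%:R)) :> R.
Proof.
move=> n0 jn; have n0' : (0 : R) < n%:R by rewrite ltr0n.
have j0 : (0 : R) < j`!%:R by rewrite ltr0n fact_gt0.
rewrite [leRHS]mulrCA [leRHS]mulrC ler_pdivlMr //.
rewrite -(ler_pM2r n0') -!mulrA mulrDl mul1r divfK ?gt_eqF //.
rewrite -!natrM -natrD -!natrM ler_nat.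
have fn : n`! = (n.-1`! * n)%N by case: n n0 {jn n0'} => // k _; rewrite factS mulnC.
have [jn'|nj] := ltnP j n; last first.
  have -> : j = n by apply/eqP; rewrite eqn_leq jn.
  have -> : (n.-1 - n = 0)%N by apply/eqP; rewrite subn_eq0 leq_pred.
  by rewrite binn !mul1n fn -mulnA leq_pmul2l ?fact_gt0 //; nia.
have bf := bin_fact jn; rewrite fn in bf.
have fnj : (n - j)`! = ((n.-1 - j)`! * (n - j))%N.
  by case: n jn' {jn bf fn n0' n0} => // k jk; rewrite subSn // factS mulnC.
rewrite fnj in bf.
rewrite -(@leq_pmul2r (n - j)) ?subn_gt0 //.
have -> : ('C(n, j) * ((n.-1 - j)`! * (j`! * n)) * (n - j) = n.-1`! * (n * n))%N.
  by rewrite [RHS]mulnA -bf; ring.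
rewrite -mulnA leq_pmul2l ?fact_gt0 //.
have [d ->] : exists d, n = (j + d.+1)%N.
  by exists (n - j).-1; rewrite prednK ?subn_gt0 // subnKC.
rewrite addKn; nia.
Qed.

End ExpSums.

Section Overlap.
Variables (R : realType) (n : nat).

(** Exponential moment of the overlap with a fixed Hamilton cycle.
Up to the last factor it is the moment generating function of a Poisson variable of
mean 1 at [1 + u]. *)
Lemma overlap_sum_le (u : R) (H0 : digraph n) : (1 < n)%N -> 0 <= u ->
  dhamcycle H0 ->
  \sum_(H : digraph n | dhamcycle H) (1 + u) ^+ #|H0 :&: H| <=
  #|[set H : digraph n | dhamcycle H]|%:R *
    (expR u * (1 + (u ^+ 2 + 2 * u) / n%:R)).
Proof.
move=> n1 u0 hH0; have n0 := ltnW n1.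
under eq_bigr do rewrite -sum_subset_expr big_mkcond.
rewrite exchange_big /=.
apply: (@le_trans _ _ (\sum_(S : digraph n | S \subset H0) u ^+ #|S| * ((n.-1 - #|S|)`!)%:R)).
  rewrite [leRHS]big_mkcond; apply: ler_sum => S _.
  rewrite -big_mkcondr /=.
  case: (boolP (S \subset H0)) => SH0; last first.
    by rewrite big_pred0 // => H; rewrite finset.subsetI (negbTE SH0) andbF.
  rewrite (eq_bigl (fun H => H \in [set H : digraph n | dhamcycle H & S \subset H])); last first.
    by move=> H; rewrite inE finset.subsetI SH0.
  rewrite sumr_const -[leLHS]mulr_natr ler_wpM2l ?exprn_ge0 // ler_nat.
  exact: (card_dhamcycle_supset hH0 SH0).
rewrite (sum_subset_card (fun j => u ^+ j * ((n.-1 - j)`!)%:R)) card_dhamcycle //.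
apply: (@le_trans _ _ (n.-1`!%:R * (expR u * (1 + (u ^+ 2 + 2 * u) / n%:R)))).
  apply: (@le_trans _ _ (n.-1`!%:R * \sum_(j < n.+1) u ^+ j / j`!%:R * (1 + (j * j.+1)%:R / n%:R))).
    rewrite mulr_sumr; apply: ler_sum => j _.
    rewrite mulrCA -(mulrA (u ^+ j)) [leRHS]mulrCA ler_wpM2l ?exprn_ge0 //.
    by apply: bin_mul_fact_le; rewrite // -ltnS.
  by rewrite ler_wpM2l // exp_moment_le.
rewrite ler_wpM2r ?ler_nat ?card_dhamcycle_ge //.
rewrite mulr_ge0 ?expR_ge0 // addr_ge0 // divr_ge0 //.
by rewrite addr_ge0 ?mulr_ge0 ?exprn_ge0.
Qed.

End Overlap.

(** * Second moment and concentration for a fixed number of arcs *)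

(** With [a = n/m] and [y = (M-m)/m], one has [n a^2 <= eta] and [y <= n a]; also
[d <= a] and [y <= d n], while [u - y] is at most [7 n a^2].  Hence the exponents [u]
and [d n] of the two competing factors differ by [O(eta)]. *)
Lemma second_moment_numeric (R : realType) (n m M eta : R) :
  1 <= n -> 0 < m <= M -> M <= n ^+ 2 -> n <= M -> 0 < eta -> 16 * eta <= 1 ->
  n ^+ 3 <= eta * m ^+ 2 ->
  let d := n * (M - m) / (m * M) in
  let r := (m - n) / (M - n) in
  let u := ((1 - d) * r)^-1 - 1 in
  [/\ 2 * n <= m, 0 <= d, d < 1 , 0 <= u &
      u - d * n <= 7 * eta /\ (u ^+ 2 + 2 * u) / n <= 405 * eta].
Proof.
move=> n1 /andP[m0 mM] Mn2 nM e0 e16 hyp d r u.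
have n0 : 0 < n by lra.
have M0 : 0 < M by lra.
pose a := n / m.
have am : a * m = n by rewrite /a divfK ?gt_eqF.
have a0 : 0 < a by rewrite divr_gt0.
have na1 : 1 <= n * a.
  by rewrite /a mulrA -expr2 ler_pdivlMr // mul1r; lra.
have nae : n * a ^+ 2 <= eta.
  rewrite /a expr_div_n mulrA -exprS ler_pdivrMr ?exprn_gt0 //.
have ae : a <= eta.
  apply: le_trans nae; rewrite expr2 mulrA; nra.
have a2 : a ^+ 2 <= 1 / 16.
  by have : 0 <= a ^+ 2 := sqr_ge0 _; nra.
have a4 : 4 * a <= 1 by nra.
have nm4 : 4 * n <= m by rewrite -am; nra.
(* Both [u] and [d n] are close to [y]. *)
pose y := (M - m) / m.
have y0 : 0 <= y by rewrite divr_ge0 // ?subr_ge0 // ltW.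
have ym : y * m = M - m by rewrite /y divfK ?gt_eqF.
have yna : y <= n * a.
  rewrite /y /a mulrA ler_pM2r ?invr_gt0 // -expr2; lra.
have d0 : 0 <= d.
  by rewrite /d divr_ge0 ?mulr_ge0 ?subr_ge0 // ltW.
have dE : d = a * (1 - m / M) by rewrite /d /a; field; rewrite !gt_eqF.
have da : d <= a.
  have : 0 <= m / M by rewrite divr_ge0 // ltW.
  by rewrite dE; nra.
have dny : y <= d * n.
  have -> : d * n = y * (n ^+ 2 / M) by rewrite /d /y; field; rewrite !gt_eqF.
  by rewrite ler_peMr // ler_pdivlMr // mul1r.
have d1 : d < 1 by lra.
have mn0 : 0 < m - n by lra.
have Mn0 : 0 < M - n by lra.
have rV : r^-1 = 1 + y / (1 - a).
  rewrite /r /y /a; field.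
  by rewrite !gt_eqF.
have zE : u = (1 - d)^-1 * (1 + y / (1 - a)) - 1.
  by rewrite /u invfM rV.
have i1 : (1 - d)^-1 <= 1 + 2 * a.
  rewrite -[leLHS]mul1r ler_pdivrMr; [nra|lra].
have i1' : 1 <= (1 - d)^-1.
  by rewrite invf_ge1; lra.
have i2 : y / (1 - a) <= y * (1 + 2 * a).
  by rewrite ler_pdivrMr; [nra|lra].
have i2' : 0 <= y / (1 - a).
  by rewrite divr_ge0 //; lra.
have u0 : 0 <= u by rewrite zE; nra.
have uy : u <= y + 7 * (n * a ^+ 2).
  have : u <= (1 + 2 * a) * (1 + y * (1 + 2 * a)) - 1.
    by rewrite zE lerD2r; apply: ler_pM => //; lra.
  have : y * a <= n * a ^+ 2 by nra.
  have : y * a * a <= n * a ^+ 2 / 4 by nra.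
  have : a <= n * a ^+ 2 by nra.
  by nra.
split=> //; first by lra.
split; first by lra.
rewrite ler_pdivrMr //.
have : u <= n * a + 7 * eta by lra.
move=> uu.
have u2 : u ^+ 2 <= 2 * (n * a) ^+ 2 + 98 * eta ^+ 2.
  have : u ^+ 2 <= (n * a + 7 * eta) ^+ 2 by rewrite lerXn2r ?nnegrE //; nra.
  have := sqr_ge0 (n * a - 7 * eta).
  by nra.
have : (n * a) ^+ 2 <= n * eta.
  rewrite (_ : (n * a) ^+ 2 = n * (n * a ^+ 2)); last by ring.
  by rewrite ler_pM2l.
have : eta ^+ 2 <= n * eta / 16 by nra.
have : 1 <= n * eta.
  by apply: le_trans na1 _; rewrite ler_pM2l.
have : 2 * u <= u ^+ 2 + 1 by have := sqr_ge0 (u - 1); lra.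
by clear -u2; lra.
Qed.

Section SecondMoment.
Variables (R : realType) (n : nat).
Hypothesis n1 : (1 < n)%N.
Let M := #|darc n|.
Let h : R := #|[set H : digraph n | dhamcycle H]|%:R.

Lemma num_ham_gt0 : 0 < h.
Proof. by rewrite /h ltr0n; apply: leq_trans (card_dhamcycle_ge n1); rewrite fact_gt0. Qed.

Lemma Expect_Dnm m : (m <= M)%N ->
  Expect (Dnm R n m) (fun D => (num_dhamcycles D)%:R) = h * ffratio R M m n.
Proof.
move=> mM; rewrite Expect_num_dhamcycles.
rewrite (eq_bigr (fun=> ffratio R M m n)); last first.
  by move=> H hH; rewrite superset_prob_Dnm // card_dhamcycle.
by rewrite sumr_const /h cardsE mulr_natl.
Qed.

Lemma Expect_Dnp p :
  Expect (Dnp n p) (fun D => (num_dhamcycles D)%:R) = h * p ^+ n.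
Proof.
rewrite Expect_num_dhamcycles.
rewrite (eq_bigr (fun=> p ^+ n)); last first.
  by move=> H hH; rewrite superset_prob_Dnp // card_dhamcycle.
by rewrite sumr_const /h cardsE mulr_natl.
Qed.

(** Two cycles that share [k] arcs use [n + (n - k)] arcs.  The factors
[f i = (m-i)/(M-i)] decrease in [i], and shifting the index by [n] costs at least
a factor [1-d]; so the last [n-k] factors are compared with the first ones,
and the missing [k] factors are each at least [r = f n]. *)
Lemma ffratio_overlap (m k : nat) : (0 < m <= M)%N -> (2 * n <= m)%N -> (k <= n)%N ->
  let d : R := n%:R * (M%:R - m%:R) / (m%:R * M%:R) in
  let r : R := (m%:R - n%:R) / (M%:R - n%:R) in
  d < 1 ->
  ffratio R M m (n + n - k) <=
  ffratio R M m n ^+ 2 * ((1 - d) ^+ n * (((1 - d) * r)^-1) ^+ k).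
Proof.
move=> /andP[m0 mM] nm kn d r d1.
have mMR : (m%:R : R) <= M%:R by rewrite ler_nat.
have nmR : 2 * n%:R <= m%:R :> R by rewrite -natrM ler_nat.
have n0R : 1 < n%:R :> R by rewrite ltr1n.
pose f i : R := (m%:R - i%:R) / (M%:R - i%:R).
have fge0 i : (i <= 2 * n)%N -> 0 <= f i.
  move=> i2; have : (i%:R : R) <= 2 * n%:R by rewrite -natrM ler_nat.
  by move=> ?; rewrite divr_ge0 ?subr_ge0; lra.
have r0 : 0 < r by rewrite divr_gt0; lra.
have fr i : (i < n)%N -> r <= f i.
  move=> i1; have : (i%:R : R) < n%:R by rewrite ltr_nat.
  move=> iR; rewrite /f ler_pdivlMr; last lra.
  rewrite /r mulrAC ler_pdivrMr; last lra.
  nra.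
have fd i : (i < n)%N -> f (n + i)%N <= (1 - d) * f i.
  move=> i1; have iR : (i%:R : R) < n%:R by rewrite ltr_nat.
  have i0 : (0 : R) <= i%:R by [].
  rewrite mulrBl mul1r lerBrDr -lerBrDl.
  have -> : f i - f (n + i)%N =
     n%:R * (M%:R - m%:R) / ((M%:R - i%:R) * (M%:R - n%:R - i%:R)).
    rewrite /f natrD; field.
    by apply/andP; split; rewrite gt_eqF //; lra.
  rewrite /d /f -!mulrA ler_wpM2l //.
  rewrite ler_wpM2l ?subr_ge0 //.
  rewrite [leRHS](_ : _ = ((M%:R - i%:R) * (M%:R - n%:R - i%:R))^-1 * 1); last first.
    by rewrite mulr1.
  rewrite [leLHS](_ : _ = ((M%:R - i%:R) * (M%:R - n%:R - i%:R))^-1 *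
     (((m%:R - i%:R) / m%:R) * ((M%:R - n%:R - i%:R) / M%:R))); last first.
    by field; apply/and4P; split; rewrite gt_eqF //; lra.
  rewrite ler_wpM2l // ?invr_ge0; first by rewrite mulr_ge0 //; lra.
  apply: mulr_ile1.
  - by apply: divr_ge0; lra.
  - by apply: divr_ge0; lra.
  - by rewrite ler_pdivrMr; lra.
  - by rewrite ler_pdivrMr; lra.
have split_ff a b : ffratio R M m (a + b) = ffratio R M m a * \prod_(i < b) f (a + i)%N.
  by rewrite /ffratio big_split_ord.
have ff0 a : (a <= n)%N -> 0 <= ffratio R M m a.
  move=> an; apply: prodr_ge0 => i _; apply: fge0.
  by rewrite (leq_trans (ltnW (ltn_ord i))) // (leq_trans an) // mul2n -addnn leq_addr.
have -> : (n + n - k = n + (n - k))%N by rewrite addnBA.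
rewrite split_ff expr2 -mulrA ler_wpM2l ?ff0 //.
apply: (@le_trans _ _ ((1 - d) ^+ (n - k) * ffratio R M m (n - k))).
  rewrite -[X in _ ^+ X]card_ord -prodr_const /ffratio -big_split /=.
  apply: ler_prod => i _.
  have ik : (i < n)%N by rewrite (leq_trans (ltn_ord i)) ?leq_subr.
  by rewrite fd // fge0 // mul2n -addnn leq_add2l ltnW.
have d1' : 0 < 1 - d by lra.
have -> : ffratio R M m n * ((1 - d) ^+ n * ((1 - d) * r)^-1 ^+ k)
   = (1 - d) ^+ (n - k) * (ffratio R M m n / r ^+ k).
  rewrite -{2}(subnK kn) exprD exprVn exprMn; field.
  by rewrite !expf_neq0 // gt_eqF.
rewrite ler_wpM2l ?exprn_ge0 ?(ltW d1') //.
rewrite ler_pdivlMr ?exprn_gt0 //.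
rewrite -{2}(subnK kn) split_ff ler_wpM2l ?ff0 ?leq_subr //.
rewrite -[X in _ ^+ X]card_ord -prodr_const.
apply: ler_prod => i _; rewrite ltW //= fr //.
by rewrite -{2}(subnK kn) ltn_add2l.
Qed.

(** The two exponential factors cancel: [exp(-d n) exp(u)] is [exp O(eta)]. *)
Lemma second_moment_le (m : nat) (eta : R) :
  (0 < m <= M)%N -> 0 < eta -> 16 * eta <= 1 ->
  n%:R ^+ 3 <= eta * m%:R ^+ 2 ->
  0 < Expect (Dnm R n m) (fun D => (num_dhamcycles D)%:R) /\
  Expect (Dnm R n m) (fun D => (num_dhamcycles D)%:R ^+ 2) <=
  Expect (Dnm R n m) (fun D => (num_dhamcycles D)%:R) ^+ 2 * expR (412 * eta).
Proof.
move=> m0M e0 e16 hyp; have /andP[m0 mM] := m0M.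
have n0R : 1 < n%:R :> R by rewrite ltr1n.
have ME : (M = n * n.-1)%N by rewrite /M card_darc.
have := @second_moment_numeric R n%:R m%:R M%:R eta.
case=> //.
- exact: ltW.
- by rewrite ltr0n m0 ler_nat.
- by rewrite ME -natrX ler_nat -mulnn leq_pmul2l ?leq_pred // ltnW.
- by rewrite ME ler_nat leq_pmulr // -subn1 subn_gt0.
set d := n%:R * _ / _; set r := (_ - n%:R) / _; set u := _^-1 - 1.
move=> nm d0 d1 u0 [ud uu].
have nm' : (2 * n <= m)%N by rewrite -(ler_nat R) natrM.
have E1 := Expect_Dnm mM.
have ff0 : 0 < ffratio R M m n.
  apply: prodr_gt0 => i _.
  have : (i%:R : R) < n%:R by rewrite ltr_nat.
  have : (m%:R : R) <= M%:R by rewrite ler_nat.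
  by move=> ? ?; rewrite divr_gt0; lra.
split; first by rewrite E1 mulr_gt0 ?num_ham_gt0.
rewrite Expect_num_dhamcycles_sqr E1.
have d1' : 0 < 1 - d by lra.
apply: (@le_trans _ _ (\sum_(H : digraph n | dhamcycle H)
  (ffratio R M m n ^+ 2 * (1 - d) ^+ n) * \sum_(H' : digraph n | dhamcycle H')
    (1 + u) ^+ #|H :&: H'|)).
  apply: ler_sum => H hH; rewrite mulr_sumr; apply: ler_sum => H' hH'.
  rewrite superset_prob_Dnm // cardsU (card_dhamcycle hH) (card_dhamcycle hH') -mulrA.
  rewrite (_ : 1 + u = ((1 - d) * r)^-1); last by rewrite /u addrC subrK.
  apply: ffratio_overlap => //.
  by apply: leq_trans (subset_leq_card (finset.subsetIl H H')) _; rewrite card_dhamcycle.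
rewrite -mulr_sumr.
apply: (@le_trans _ _ ((ffratio R M m n ^+ 2 * (1 - d) ^+ n) *
   (h * (h * (expR u * (1 + (u ^+ 2 + 2 * u) / n%:R)))))).
  rewrite ler_wpM2l ?mulr_ge0 ?exprn_ge0 ?(ltW d1') ?(ltW ff0) //.
  rewrite [X in _ <= X * _](_ : h = \sum_(H : digraph n | dhamcycle H) 1); last first.
    by rewrite sumr_const /h cardsE.
  rewrite mulr_suml; apply: ler_sum => H hH; rewrite mul1r.
  exact: overlap_sum_le.
rewrite [leLHS](_ : _ = (h * ffratio R M m n) ^+ 2 *
  ((1 - d) ^+ n * (expR u * (1 + (u ^+ 2 + 2 * u) / n%:R)))); last by ring.
rewrite ler_wpM2l ?sqr_ge0 //.
apply: (@le_trans _ _ (expR (- d * n%:R) * (expR u * expR (405 * eta)))).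
  apply: ler_pM.
  - by rewrite exprn_ge0 // ltW.
  - rewrite mulr_ge0 ?expR_ge0 // addr_ge0 // divr_ge0 //.
    by rewrite addr_ge0 ?mulr_ge0 ?exprn_ge0.
  - rewrite expRM_natr lerXn2r ?nnegrE ?(ltW d1') ?expR_ge0 //.
    exact: expR_ge1Dx.
  - rewrite ler_pM2l ?expR_gt0 //; apply: le_trans (expR_ge1Dx _).
    by rewrite lerD2l.
rewrite -!expRD ler_expR; lra.
Qed.

End SecondMoment.

(** The constant [C] depends on [eps] only, and not on [m]: the same bound is used
for every plausible number of arcs when that number is random. *)
Theorem concentration (R : realType) (eps : R) : 0 < eps ->
  exists2 C : R, 0 < C & forall n m : nat, (1 < n)%N -> (0 < m <= #|darc n|)%N ->
  C * n%:R ^+ 3 <= m%:R ^+ 2 ->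
  let mu := Expect (Dnm R n m) (fun D => (num_dhamcycles D)%:R) in
  0 < mu /\
  Prob (Dnm R n m) (fun D => eps < `|(num_dhamcycles D)%:R / mu - 1|) <= eps.
Proof.
move=> e0; have l0 : 0 < ln (1 + eps ^+ 3) by rewrite ln_gt0 // ltrDl exprn_gt0.
(* The relative variance must be at most [eps^3] for Chebyshev's bound
   [eps^3 / eps^2]; 412 is the constant of [second_moment_le], and [16 <= C]
   gives its hypothesis [16 eta <= 1] for [eta = 1/C]. *)
pose C : R := 16 + 412 / ln (1 + eps ^+ 3).
have C16 : 16 <= C by rewrite lerDl; apply: divr_ge0; [exact: ler0n | exact: ltW].
have C0 : 0 < C by lra.
have CV : 0 < C^-1 by rewrite invr_gt0.
exists C => // n m n1 m0M hC mu; have /andP[m0 mM] := m0M.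
have hyp : n%:R ^+ 3 <= C^-1 * m%:R ^+ 2 by rewrite mulrC ler_pdivlMr // mulrC.
have C16' : 16 * C^-1 <= 1 by rewrite ler_pdivrMr // mul1r.
have [mu0 mu2] := second_moment_le n1 m0M CV C16' hyp; rewrite -/mu in mu0 mu2.
split=> //.
apply: le_trans
  (@chebyshev_ratio R _ _ _ _ (fun D => (num_dhamcycles D)%:R) mu eps _ mu0 e0) _ => //.
- by move=> D; exact: Dnm_ge0.
- exact: Dnm_sum1.
rewrite ler_pdivrMr ?exprn_gt0 // -exprS lerBlDr ler_pdivrMr ?exprn_gt0 //.
apply: le_trans mu2 _; rewrite mulrC ler_wpM2r ?sqr_ge0 //.
rewrite addrC -[leRHS]lnK ?posrE; last by rewrite ltr_pwDl // exprn_ge0 // ltW.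
rewrite ler_expR ler_pdivrMr // mulrC -ler_pdivrMr //.
by rewrite lerDr.
Qed.

(** * The Gaussian distribution function *)

Section Gaussian.
Variable R : realType.
Local Open Scope classical_set_scope.
Notation mu := (@lebesgue_measure R).
Notation nu := (normal_prob 0 1 : probability (measurableTypeR R) R).

Definition Phi (x : R) : R := fine (nu `]-oo, x]).

Let idTR : measurableTypeR R -> R := idfun.
#[local] HB.instance Definition _ :=
  @isMeasurableFun.Build _ _ _ _ idTR (@measurable_id _ _ setT).

Lemma PhiE x : (Phi x)%:E = nu `]-oo, x].
Proof. by rewrite fineK // fin_num_measure. Qed.

Lemma Phi_ge0 x : 0 <= Phi x.
Proof. by rewrite fine_ge0. Qed.

Lemma Phi_le1 x : Phi x <= 1.
Proof. by rewrite -lee_fin PhiE probability_le1. Qed.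

Lemma PhiB a b : a <= b -> (Phi b - Phi a)%:E = nu `]a, b].
Proof.
move=> ab; rewrite EFinB !PhiE.
rewrite (_ : `]-oo, b] = `]-oo, a] `|` `]a, b]); last first.
  by rewrite -itv_bndbnd_setU.
rewrite measureU //=; last first.
  by apply/seteqP; split => // x /=; rewrite !in_itv /= => -[xa /andP[/lt_geF]]; rewrite xa.
by rewrite addeAC subee ?add0e // fin_num_measure.
Qed.

Lemma PhiB_bounds a b l u : a <= b -> 0 <= l ->
  (forall s, a <= s <= b -> l <= normal_pdf 0 1 s <= u) ->
  l * (b - a) <= Phi b - Phi a <= u * (b - a).
Proof.
move=> ab l0 lu.
have len : mu `]a, b] = (b - a)%:E.
  rewrite lebesgue_measure_itv /= lte_fin; case: ltP => [_|ba]; first by rewrite EFinB.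
  have -> : a = b by apply/eqP; rewrite eq_le ab ba.
  by rewrite subrr.
have u0 : 0 <= u.
  by have /andP[] := lu a (introT andP (conj (lexx a) ab)) => /(le_trans l0)/le_trans; apply.
have mpdf : measurable_fun (`]a, b] : set R) (EFin \o (normal_pdf (0 : R) 1)).
  by apply: measurable_funTS; apply/measurable_EFinP; exact: measurable_normal_pdf.
have inab x : `]a, b] x -> a <= x <= b.
  by rewrite /= in_itv /= => /andP[/ltW -> ->].
rewrite -!lee_fin PhiB // [nu _]/(normal_prob _ _ _) /normal_prob !EFinM -len.
rewrite -!integral_cst //; apply/andP; split; apply: ge0_le_integral => //=.
- by move=> x /inab /lu /andP[+ _]; rewrite lee_fin.
- by move=> x _; rewrite lee_fin normal_pdf_ge0.
- by move=> x /inab /lu /andP[_ +]; rewrite lee_fin.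
Qed.

Lemma Phi_mono a b : a <= b -> Phi a <= Phi b.
Proof. by move=> ab; rewrite -subr_ge0 -lee_fin PhiB. Qed.

Lemma Phi_tails (eps : R) : 0 < eps ->
  exists2 A, 0 < A & forall y, A <= y -> Phi (- y) <= eps /\ 1 - eps <= Phi y.
Proof.
move=> e0.
have /fine_cvgP[_ /cvgrPdist_le/(_ _ e0)[A1 [_ A1P]]] :=
  @cvg_cdfy1 _ _ _ nu (idTR : {RV nu >-> R}).
have /fine_cvgP[_ /cvgrPdist_le/(_ _ e0)[A0 [_ A0P]]] :=
  @cvg_cdfNy0 _ _ _ nu (idTR : {RV nu >-> R}).
exists (1 + `|A1| + `|A0|); first by rewrite addrAC ltr_wpDr // ltr_wpDr.
move=> y Ay.
have {}A1P : `|1 - Phi y| <= eps.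
  by apply: A1P; have := ler_norm A1; have := normr_ge0 A0; lra.
have {}A0P : `|0 - Phi (- y)| <= eps.
  by apply: A0P; have := ler_norm (- A0); rewrite normrN; have := normr_ge0 A1; lra.
move: A1P A0P; rewrite sub0r normrN !ler_norml => /andP[_ ?] /andP[_ ?].
by split; lra.
Qed.

End Gaussian.

(** * Logarithm estimates and the binomial distribution *)

Section LnBounds.
Variable R : realType.
Implicit Types x : R.

Lemma ln1D_le x : -1 < x -> ln (1 + x) <= x.
Proof.
move=> x1; rewrite -ler_expR lnK ?posrE; last by lra.
exact: expR_ge1Dx.
Qed.

Lemma ln1D_approx x : - 2^-1 <= x -> `|ln (1 + x) - x| <= 2 * x ^+ 2.
Proof.
move=> x1; have p1 : 0 < 1 + x by lra.
have up : ln (1 + x) <= x by apply: ln1D_le; lra.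
have lo : x - 2 * x ^+ 2 <= ln (1 + x).
  have : ln (1 + - x / (1 + x)) <= - x / (1 + x).
    by apply: ln1D_le; rewrite ltr_pdivlMr //; lra.
  have -> : 1 + - x / (1 + x) = (1 + x)^-1 by field; rewrite gt_eqF.
  rewrite lnV ?posrE // lerNl => /(le_trans _); apply.
  rewrite mulNr opprK ler_pdivlMr //.
  have : 0 <= x ^+ 2 * (1 + 2 * x) by rewrite mulr_ge0 ?sqr_ge0 //; lra.
  by rewrite mulrDr mulr1; nra.
by rewrite ler_norml; have := sqr_ge0 x; lra.
Qed.

End LnBounds.

Section GaussianStep.
Variable R : realType.

Lemma normal_pdf01E (s : R) : normal_pdf 0 1 s = normal_peak 1 * expR (- (s ^+ 2 / 2)).
Proof.
by rewrite normal_pdfE ?oner_eq0 // /normal_fun subr0 expr1n mulNr.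
Qed.

Lemma normal_peak1_gt0 : 0 < normal_peak 1 :> R.
Proof. exact: normal_peak_gt0 (oner_neq0 _). Qed.

(** On a cell of length [d] at distance at most [A] from the origin, the exponent
[s^2/2] varies by at most [(A+1) d]. *)
Lemma PhiB_step (A t d : R) : `|t| <= A -> 0 <= d <= 1 ->
  let g := normal_peak 1 * expR (- (t ^+ 2 / 2)) * d in
  is_true (g * expR (- ((A + 1) * d)) <= Phi (t + d) - Phi t <= g * expR ((A + 1) * d)).
Proof.
move=> tA /andP[d0 d1] g.
have P0 : 0 < normal_peak 1 :> R := normal_peak1_gt0.
have tA' : - A <= t <= A by rewrite -ler_norml.
have := @PhiB_bounds R t (t + d)
  (normal_peak 1 * expR (- (t ^+ 2 / 2)) * expR (- ((A + 1) * d)))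
  (normal_peak 1 * expR (- (t ^+ 2 / 2)) * expR ((A + 1) * d)).
rewrite (_ : t + d - t = d); last by ring.
rewrite (mulrAC _ (expR (- ((A + 1) * d)))) (mulrAC _ (expR ((A + 1) * d))).
apply.
- lra.
- by rewrite !mulr_ge0 ?expR_ge0 // ltW.
move=> s /andP[ts sd]; rewrite normal_pdf01E -!mulrA !ler_pM2l // -!expRD !ler_expR.
have -> : s = t + (s - t) by ring.
have : 0 <= s - t <= d by lra.
move: (s - t) => e /andP[e0 ed].
have e1 : e <= 1 by lra.
have te : - A * e <= t * e <= A * e by rewrite !ler_wpM2r //; lra.
have ee : 0 <= e * e <= e by nra.
by have A0 : 0 <= A; [lra | nra].
Qed.

Lemma Phi_lip (a b : R) : a <= b -> Phi b <= Phi a + normal_peak 1 * (b - a).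
Proof.
move=> ab; rewrite -lerBlDl.
have H s : a <= s <= b -> 0 <= normal_pdf 0 1 s <= normal_peak 1.
  by move=> _; rewrite normal_pdf_ge0 normal_pdf_ub // oner_neq0.
by have /andP[] := PhiB_bounds ab (lexx 0) H.
Qed.

End GaussianStep.

Section Binomial.
Variable R : realType.
Implicit Types (p : R) (M k : nat).

Lemma binw_ge0 M p k : 0 <= p <= 1 -> 0 <= binw M p k.
Proof.
by move=> /andP[p0 p1]; rewrite /binw !mulr_ge0 ?exprn_ge0 // subr_ge0.
Qed.

Lemma binw_gt0 M p k : 0 < p < 1 -> (k <= M)%N -> 0 < binw M p k.
Proof.
move=> /andP[p0 p1] kM; rewrite /binw !mulr_gt0 ?exprn_gt0 ?subr_gt0 //.
by rewrite ltr0n bin_gt0.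
Qed.

Lemma sum_binw M p : \sum_(k < M.+1) binw M p k = 1.
Proof.
have -> : 1 = (1 - p + p) ^+ M by rewrite subrK expr1n.
rewrite exprDn; apply: eq_bigr => k _; rewrite /binw -mulr_natr; ring.
Qed.

(** The ratio of consecutive weights is [(M-k)p / ((k+1)(1-p))]; the form without
division avoids side conditions. *)
Lemma binw_step M p k : (k < M)%N ->
  binw M p k.+1 * (k.+1%:R * (1 - p)) = binw M p k * ((M - k)%:R * p).
Proof.
move=> kM; rewrite /binw.
have -> : (M - k = (M - k.+1).+1)%N by rewrite subnSK.
have E : k.+1%:R * ('C(M, k.+1))%:R = (M - k.+1).+1%:R * 'C(M, k)%:R :> R.
  by rewrite -!natrM subnSK // mul_bin_left.
rewrite !exprS.
rewrite [LHS](_ : _ = k.+1%:R * ('C(M, k.+1))%:R *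
  (p * p ^+ k * (1 - p) ^+ (M - k.+1) * (1 - p))); last by ring.
rewrite E; ring.
Qed.

(** The size-biased binomial law is one plus a binomial law with one trial fewer. *)
Lemma sum_binw_shift M p (f : nat -> R) :
  \sum_(k < M.+2) binw M.+1 p k * (k%:R * f k) =
  M.+1%:R * p * \sum_(k < M.+1) binw M p k * f k.+1.
Proof.
rewrite big_ord_recl mul0r mulr0 add0r mulr_sumr; apply: eq_bigr => k _.
rewrite /= /bump /= add1n /binw subSS exprS.
have E : M.+1%:R * 'C(M, k)%:R = k.+1%:R * ('C(M.+1, k.+1))%:R :> R.
  by rewrite -!natrM (mul_bin_diag M.+1 k).
rewrite [RHS](_ : _ = M.+1%:R * 'C(M, k)%:R *
  (p * p ^+ k * (1 - p) ^+ (M - k) * f k.+1)); last by ring.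
by rewrite E; ring.
Qed.

Lemma binw_variance M p :
  \sum_(k < M.+1) binw M p k * (k%:R - M%:R * p) ^+ 2 = M%:R * p * (1 - p).
Proof.
case: M => [|M].
  by rewrite big_ord_recl big_ord0 !mul0r subrr expr0n /= mulr0 addr0.
set mu := M.+1%:R * p.
transitivity (\sum_(k < M.+2) binw M.+1 p k * (k%:R * (k%:R - 2 * mu)) +
   mu ^+ 2 * \sum_(k < M.+2) binw M.+1 p k).
  by rewrite mulr_sumr -big_split; apply: eq_bigr => k _ /=; ring.
rewrite sum_binw (sum_binw_shift _ _ (fun k => k%:R - 2 * mu)).
have mean : \sum_(k < M.+1) binw M p k * k%:R = M%:R * p.
  case: M @mu => [|M'] _; first by rewrite big_ord_recl big_ord0 mulr0 mul0r addr0.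
  transitivity (\sum_(k < M'.+2) binw M'.+1 p k * (k%:R * 1)).
    by apply: eq_bigr => k _; rewrite mulr1.
  rewrite (sum_binw_shift M' p (fun=> 1)).
  by under eq_bigr do rewrite mulr1; rewrite sum_binw mulr1.
rewrite (_ : \sum_(k < M.+1) _ = M%:R * p + (1 - 2 * mu)); last first.
  rewrite -mean (_ : 1 - 2 * mu = \sum_(k < M.+1) binw M p k * (1 - 2 * mu)); last first.
    by rewrite -mulr_suml sum_binw mul1r.
  rewrite -big_split.
  by apply: eq_bigr => k _ /=; rewrite -natr1; ring.
by rewrite /mu -natr1; ring.
Qed.

End Binomial.

(** * De Moivre-Laplace with varying success probability *)

Section LocalLimit.
Variables (R : realType) (M : nat) (p sd : R).
Hypothesis p01 : 0 < p < 1.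

Definition binstd (k : nat) : R := (k%:R - M%:R * p) / sd.

Let p0 : 0 < p. Proof. by case/andP: p01. Qed.
Let p1 : p < 1. Proof. by case/andP: p01. Qed.
Let p01' : 0 <= p <= 1. Proof. by rewrite !ltW. Qed.

Hypotheses (s0 : 0 < sd) (binsd_sqr : sd ^+ 2 = M%:R * p * (1 - p)).
Local Notation t := binstd.

Lemma binstdK k : k%:R = M%:R * p + t k * sd.
Proof. by rewrite /binstd divfK ?gt_eqF // addrC subrK. Qed.

Lemma binstdS k : t k.+1 = t k + sd^-1.
Proof. by rewrite /binstd -natr1 addrAC mulrDl mul1r. Qed.

Lemma binstd_le i k : (t i <= t k) = (i <= k)%N.
Proof. by rewrite /binstd ler_pM2r ?invr_gt0 // lerD2r ler_nat. Qed.

Lemma binw_tail A : 0 < A ->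
  \sum_(k < M.+1 | A <= `|t k|) binw M p k <= (A ^+ 2)^-1.
Proof.
move=> A0; rewrite -[leRHS]mul1r ler_pdivlMr ?exprn_gt0 //.
have <- : \sum_(k < M.+1) binw M p k * t k ^+ 2 = 1.
  apply: (mulIf (x := sd ^+ 2)); first by rewrite expf_neq0 // gt_eqF.
  rewrite mulr_suml mul1r {2}binsd_sqr -binw_variance; apply: eq_bigr => k _.
  by rewrite -mulrA -exprMn /binstd divfK // gt_eqF.
rewrite mulr_suml big_mkcond /=; apply: ler_sum => k _.
case: ifP => Ak; last by rewrite mulr_ge0 ?binw_ge0 ?sqr_ge0.
rewrite ler_wpM2l ?binw_ge0 // -[leRHS]real_normK ?num_real //.
by rewrite lerXn2r ?nnegrE // ltW.
Qed.

(** Logarithm of the binomial weight relative to the Gaussian profile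
[exp(-t^2/2)]; it is nearly constant on windows of bounded [t]. *)
Definition logdens k : R := ln (binw M p k) + t k ^+ 2 / 2.

Variable A : R.
Hypotheses (A0 : 0 <= A) (As : 2 * (A + 1) <= sd).

Let sV0 : 0 < sd^-1. Proof. by rewrite invr_gt0. Qed.
Let sV : (A + 1) * sd^-1 <= 2^-1.
Proof. by rewrite ler_pdivrMr //; have := As; lra. Qed.
Let sV1 : sd^-1 <= 1.
Proof. by have : 0 <= A * sd^-1; [rewrite mulr_ge0 // ltW | have := sV; lra]. Qed.

(** The logarithm of the ratio of consecutive weights is [-t/sd + O(1/sd^2)], which is
also the increment of [-t^2/2] over a step of length [1/sd]. *)
Lemma logdens_step k : (k < M)%N -> `|t k| <= A ->
  `|logdens k.+1 - logdens k| <= 5 * (A + 1) ^+ 2 * (sd^-1) ^+ 2.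
Proof.
have A_0 := A0; have p_0 := p0; have p_1 := p1.
move=> kM tA; set s := sd^-1; set T := t k.
have /andP[TA1 TA2] : - A <= T <= A by rewrite -ler_norml.
pose x1 := - (p * (T * s)); pose x2 := (1 - p) * (T * s + s ^+ 2).
have s_0 : 0 < s := sV0. have s_1 : s <= 1 := sV1. have sA : (A + 1) * s <= 2^-1 := sV.
have Ts : - (A * s) <= T * s <= A * s.
  by rewrite -mulNr !ler_wpM2r // ltW.
have x1A : - ((A + 1) * s) <= x1 <= (A + 1) * s.
  by rewrite /x1; nra.
have x2A : - ((A + 1) * s) <= x2 <= (A + 1) * s.
  have : - ((A + 1) * s) <= T * s + s ^+ 2 <= (A + 1) * s.
    by have : 0 <= s ^+ 2 <= s; nra.
  by rewrite /x2; nra.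
have b0 : 0 < binw M p k by rewrite binw_gt0 // ltnW.
have b1 : 0 < binw M p k.+1 by rewrite binw_gt0.
have y1 : 0 < 1 + x1 by lra.
have y2 : 0 < 1 + x2 by lra.
have E : binw M p k.+1 * (1 + x2) = binw M p k * (1 + x1).
  have sd2 := binsd_sqr; have sdn : sd != 0 by rewrite gt_eqF.
  apply: (mulIf (x := sd ^+ 2)); first by rewrite expf_neq0.
  have := binw_step p kM; rewrite natrB ?(ltnW kM) // -natr1 binstdK -/T.
  have -> : (M%:R - (M%:R * p + T * sd)) * p = (1 + x1) * sd ^+ 2.
    by rewrite [RHS]mulrDl mul1r [X in _ = X + _]sd2 /x1 /s; field.
  have -> : (M%:R * p + T * sd + 1) * (1 - p) = (1 + x2) * sd ^+ 2.
    by rewrite [RHS]mulrDl mul1r [X in _ = X + _]sd2 /x2 /s; field.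
  by rewrite !mulrA.
have /(congr1 (@ln R)) : binw M p k.+1 * (1 + x2) = binw M p k * (1 + x1) by [].
rewrite [LHS]lnM ?posrE // [RHS]lnM ?posrE // => lnE.
have h1 : - 2^-1 <= x1 by lra.
have h2 : - 2^-1 <= x2 by lra.
have := ln1D_approx h1; have := ln1D_approx h2.
rewrite /logdens binstdS -/T -/s.
rewrite !ler_norml => /andP[l2 l2'] /andP[l1 l1'].
have q1 : x1 ^+ 2 <= (A + 1) ^+ 2 * s ^+ 2.
  rewrite -exprMn -(real_normK (num_real x1)) lerXn2r ?nnegrE ?ler_norml //.
  by rewrite mulr_ge0 // ltW // ltr_wpDl.
have q2 : x2 ^+ 2 <= (A + 1) ^+ 2 * s ^+ 2.
  rewrite -exprMn -(real_normK (num_real x2)) lerXn2r ?nnegrE ?ler_norml //.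
  by rewrite mulr_ge0 // ltW // ltr_wpDl.
have q3 : 0 <= s ^+ 2 <= (A + 1) ^+ 2 * s ^+ 2.
  by rewrite sqr_ge0 ler_peMl ?sqr_ge0 //; nra.
have xx : x1 - x2 = - (T * s) - (1 - p) * s ^+ 2 by rewrite /x1 /x2; ring.
have q4 : 0 <= (1 - p) * s ^+ 2 <= s ^+ 2 by nra.
have q5 : (T + s) ^+ 2 = T ^+ 2 + 2 * (T * s) + s ^+ 2 by ring.
by rewrite q5; apply/andP; split; lra.
Qed.

(** A window contains [O(sd)] steps, so the total variation is [O(1/sd)]. *)
Lemma logdens_chain k0 i : (k0 + i <= M)%N -> - A <= t k0 -> t (k0 + i)%N <= A ->
  `|logdens (k0 + i) - logdens k0| <= i%:R * (5 * (A + 1) ^+ 2 * (sd^-1) ^+ 2).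
Proof.
move=> + tk0; elim: i => [|i IHi]; first by rewrite addn0 subrr normr0 mul0r.
rewrite addnS => kM tA.
have tA' : t (k0 + i)%N <= A by apply: le_trans tA; rewrite binstd_le.
have nA : `|t (k0 + i)%N| <= A.
  by rewrite ler_norml tA' andbT; apply: le_trans tk0 _; rewrite binstd_le leq_addr.
have h1 := logdens_step kM nA; have h2 := IHi (ltnW kM) tA'.
rewrite (_ : _ - _ = (logdens (k0 + i) - logdens k0) +
   (logdens (k0 + i).+1 - logdens (k0 + i))); last by ring.
by rewrite -natr1 mulrDl mul1r (le_trans (ler_normD _ _)) // lerD.
Qed.

Definition gauss_cell k : R := Phi (t k.+1) - Phi (t k).

Definition locerr : R := 11 * (A + 1) ^+ 3 * sd^-1.

(** All binomial weights in the window are the same multiple [c] of the Gaussian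
masses of their cells, up to the factor [exp locerr]. *)
Lemma binw_cell k0 k : (k0 <= k <= M)%N -> - A <= t k0 -> t k <= A ->
  let c := expR (logdens k0) * sd / normal_peak 1 in
  c * expR (- locerr) * gauss_cell k <= binw M p k /\
  binw M p k <= c * expR locerr * gauss_cell k.
Proof.
have A_0 := A0; move=> /andP[k0k kM] tk0 tk c.
have P0 : 0 < normal_peak 1 :> R := @normal_peak1_gt0 R.
have nk : `|t k| <= A.
  by rewrite ler_norml tk andbT (le_trans tk0) // binstd_le.
have ik : k = (k0 + (k - k0))%N by rewrite subnKC.
have := @logdens_chain k0 (k - k0); rewrite -ik => /(_ kM tk0 tk).
have -> : (k - k0)%:R = (t k - t k0) * sd.
  by rewrite /binstd -mulrBl divfK ?gt_eqF // natrB //; ring.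
have : (t k - t k0) * sd * (5 * (A + 1) ^+ 2 * sd^-1 ^+ 2) <= 10 * A * (A + 1) ^+ 2 * sd^-1.
  rewrite [leLHS](_ : _ = (t k - t k0) * (5 * (A + 1) ^+ 2 * sd^-1)); last first.
    by field; rewrite gt_eqF.
  rewrite [leRHS](_ : _ = 2 * A * (5 * (A + 1) ^+ 2 * sd^-1)); last by ring.
  by rewrite ler_wpM2r ?mulr_ge0 ?sqr_ge0 ?(ltW sV0) //; lra.
move=> h1 h2; have {h1 h2} := le_trans h2 h1.
rewrite ler_norml => /andP[lo up].
have le : 10 * A * (A + 1) ^+ 2 * sd^-1 + (A + 1) * sd^-1 <= locerr.
  rewrite /locerr -mulrDl ler_wpM2r ?(ltW sV0) //.
  have : 0 <= A * A by rewrite mulr_ge0.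
  have : 0 <= A * A * A by rewrite !mulr_ge0.
  by rewrite !exprS expr0; lra.
have b0 : 0 < binw M p k by rewrite binw_gt0.
have bE : binw M p k = expR (logdens k) * expR (- (t k ^+ 2 / 2)).
  by rewrite -expRD /logdens addrK lnK.
have s01 : 0 <= sd^-1 <= 1 by rewrite (ltW sV0) sV1.
have := PhiB_step nk s01; rewrite -binstdS -/(gauss_cell k) => /andP[q1 q2].
set g := expR (- (t k ^+ 2 / 2)) in bE q1 q2.
have g0 : 0 < g by exact: expR_gt0.
have c0 : 0 < c by rewrite divr_gt0 // mulr_gt0 ?expR_gt0.
split.
  apply: le_trans (ler_wpM2l _ q2) _; first by rewrite mulr_ge0 ?expR_ge0 // ltW.
  rewrite bE.
  rewrite [leLHS](_ : _ =
    (expR (logdens k0) * expR (- locerr) * expR ((A + 1) * sd^-1)) * g); last first.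
    by rewrite /c; field; rewrite !gt_eqF.
  by rewrite ler_pM2r // -!expRD ler_expR; lra.
apply: le_trans (ler_wpM2l _ q1); last by rewrite mulr_ge0 ?expR_ge0 // ltW.
rewrite bE.
rewrite [leRHS](_ : _ =
  (expR (logdens k0) * expR locerr * expR (- ((A + 1) * sd^-1))) * g); last first.
  by rewrite /c; field; rewrite !gt_eqF.
by rewrite ler_pM2r // -!expRD ler_expR; lra.
Qed.

(** If [M p + y sd >= 0], the first index whose standardised value exceeds [y]. *)
Definition bincut (y : R) : nat := (Num.truncn (M%:R * p + y * sd)).+1.

Lemma bincutP y k : 0 <= M%:R * p + y * sd -> (k < bincut y)%N = (t k <= y).
Proof.
move=> y0; rewrite /bincut ltnS truncn_ge_nat // /binstd ler_pdivrMr //.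
by rewrite lerBlDl.
Qed.

Lemma bincut_bounds y : 0 <= M%:R * p + y * sd -> y < t (bincut y) <= y + sd^-1.
Proof.
move=> y0; apply/andP; split; first by rewrite ltNge -(bincutP _ y0) ltnn.
by rewrite {1}/bincut binstdS lerD2r -(bincutP _ y0) /bincut ltnS.
Qed.

End LocalLimit.

(** Here [lt], [mid] and [Bw] stand for binomial masses of a lower tail, of a part of the
window and of the whole window, and [Qx], [Qw] for the Gaussian masses of the
same parts.  The bounds on [Bw] and [Qw] force the unknown constant [c] to be
nearly 1. *)
Lemma clt_numeric (R : realType) (d F lt mid Bw Qx Qw c E : R) :
  0 < d -> 20 * d <= 1 -> 0 <= F <= 1 -> 0 <= lt <= d -> 0 <= mid <= 1 ->
  1 - d <= Bw <= 1 -> 0 < c -> 1 <= E -> E <= 1 + 2 * d ->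
  c * E^-1 * Qx <= mid <= c * E * Qx -> c * E^-1 * Qw <= Bw <= c * E * Qw ->
  F - 2 * d <= Qx <= F + d -> 1 - 3 * d <= Qw <= 1 ->
  `|lt + mid - F| <= 20 * d.
Proof.
move=> d0 d20 F01 lt0 mid0 Bw1 c0 E1 E2 /andP[m1 m2] /andP[w1 w2] Qxb Qw1.
have E0 : 0 < E by lra.
have {}m1 : c * Qx <= mid * E by rewrite -ler_pdivrMr // mulrAC.
have {}w1 : c * Qw <= Bw * E by rewrite -ler_pdivrMr // mulrAC.
have EE : E * E <= 1 + 5 * d by nra.
have dd : d * d <= d / 20 by nra.
have cE : c * (1 - 3 * d) <= E by nra.
have c6 : c <= E * (1 + 6 * d) by nra.
have cEE : c * E <= 1 + 13 * d.
  have : c * E <= E * (1 + 6 * d) * E by rewrite ler_pM2r.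
  nra.
have cE' : 1 - d <= c * E by nra.
have up : mid <= F + 15 * d.
  have : c * E * Qx <= c * E * (F + d) by rewrite ler_pM2l ?mulr_gt0 //; lra.
  have : c * E * (F + d) <= (1 + 13 * d) * (F + d) by rewrite ler_wpM2r //; lra.
  have : d * F <= d * 1 by rewrite ler_pM2l //; lra.
  by lra.
have lo : F - 10 * d <= mid.
  have [F2|F2] := lerP F (2 * d); first by lra.
  have Qx0 : 0 < Qx by lra.
  have : c * E * Qx <= mid * (E * E).
    by rewrite mulrAC mulrA ler_pM2r.
  have : (1 - d) * Qx <= c * E * Qx by rewrite ler_pM2r.
  have : mid * (E * E) <= mid + 5 * d.
    have : mid * (E * E) <= mid * (1 + 5 * d) by rewrite ler_wpM2l //; lra.
    have : d * mid <= d * 1 by rewrite ler_pM2l //; lra.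
    by lra.
  have : d * Qx <= d * 2 by rewrite ler_pM2l //; lra.
  by lra.
by rewrite ler_norml; apply/andP; split; lra.
Qed.

Lemma expR_le1D2x (R : realType) (x : R) : 0 <= x <= 2^-1 -> expR x <= 1 + 2 * x.
Proof.
move=> x01; rewrite -[expR x]invrK -expRN.
have h : 1 - x <= expR (- x) by exact: expR_ge1Dx.
apply: (@le_trans _ _ (1 - x)^-1).
  by rewrite lef_pV2 ?posrE ?expR_gt0 //; lra.
rewrite -[leLHS]mul1r ler_pdivrMr; last by lra.
by nra.
Qed.

(** Uniform in [p]: only a large variance is required, so that [p] may depend on
the number of trials. *)
Theorem binomial_clt (R : realType) (x eps : R) : 0 < eps ->
  exists2 S : R, 0 < S & forall (M : nat) (p sd : R), 0 < p < 1 ->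
  S <= sd -> sd ^+ 2 = M%:R * p * (1 - p) ->
  `|\sum_(k < M.+1 | binstd M p sd k <= x) binw M p k - Phi x| <= eps.
Proof.
move=> e0; pose d := Num.min (20^-1) (eps / 20).
have d0 : 0 < d by rewrite lt_min invr_gt0 ltr0n /= divr_gt0.
have d20 : 20 * d <= 1.
  have : d <= 20^-1 by rewrite ge_min lexx.
  by lra.
have de : 20 * d <= eps.
  have : d <= eps / 20 by rewrite ge_min lexx orbT.
  by lra.
have dV : 20 <= d^-1 by rewrite -[leLHS]invrK lef_pV2 ?posrE //; lra.
clearbody d.
have [A1 A10 A1P] := Phi_tails d0.
(* The window contains [x], carries Gaussian mass at least [1 - 2d], and
   binomial mass at least [1 - 1/A^2], hence at least [1 - d]. *)
pose A : R := 1 + `|x| + A1 + d^-1.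
have xA : `|x| <= A by have := normr_ge0 x; rewrite /A; lra.
have AA1 : A1 <= A by have := normr_ge0 x; rewrite /A; lra.
have AdV : d^-1 <= A by have := normr_ge0 x; rewrite /A; lra.
have A0 : 0 < A by lra.
clearbody A.
have [PA1 PA2] := A1P _ AA1.
have P0 : 0 < normal_peak 1 :> R := @normal_peak1_gt0 R.
pose S : R := 2 * (A + 1) + 11 * (A + 1) ^+ 3 / d + normal_peak 1 / d.
have S2 : 0 < 11 * (A + 1) ^+ 3 / d by rewrite divr_gt0 // mulr_gt0 // exprn_gt0 //; lra.
have S3 : 0 < normal_peak 1 / d by rewrite divr_gt0.
exists S; first by rewrite /S; lra.
move=> M p sd p01 Ssd sd2; have /andP[p0 p1] := p01.
have s0 : 0 < sd by rewrite /S in Ssd; lra.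
have As : 2 * (A + 1) <= sd by rewrite /S in Ssd; lra.
have lerr : locerr sd A <= d.
  by rewrite /locerr ler_pdivrMr // [leRHS]mulrC -ler_pdivrMr //; rewrite /S in Ssd; lra.
have perr : normal_peak 1 * sd^-1 <= d.
  by rewrite ler_pdivrMr // [leRHS]mulrC -ler_pdivrMr //; rewrite /S in Ssd; lra.
have sA : A * sd <= sd ^+ 2 by rewrite expr2 ler_pM2r //; lra.
have p01' : 0 <= p <= 1 by rewrite !ltW.
have M0 : 0 <= M%:R :> R by [].
have muA : A * sd <= M%:R * p.
  apply: le_trans sA _; rewrite sd2 ler_piMr ?mulr_ge0 ?(ltW p0) //; lra.
have muA' : M%:R * p + A * sd <= M%:R.
  have : sd ^+ 2 <= M%:R * (1 - p).
    by rewrite sd2 mulrAC ler_piMr ?mulr_ge0 ?(ltW p1) // subr_ge0 ltW.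
  by lra.
pose t := binstd M p sd.
have cut0 y : - A <= y -> 0 <= M%:R * p + y * sd.
  by move=> yA; have : - A * sd <= y * sd; [rewrite ler_pM2r | lra].
have cutM y : y <= A -> (bincut M p sd y <= M.+1)%N.
  move=> yA; rewrite /bincut ltnS truncn_le_nat.
  apply: le_lt_trans (_ : M%:R < _); last by rewrite ltr_nat.
  by apply: le_trans muA'; rewrite lerD2l ler_pM2r.
set k0 := bincut M p sd (- A).
have k0b := bincut_bounds s0 (cut0 _ (lexx _)); rewrite -/k0 -/t in k0b.
have window y (f : nat -> R) : - A <= y -> y <= A ->
  \sum_(k < M.+1 | (- A < t k) && (t k <= y)) f k =
  \sum_(k0 <= k < bincut M p sd y) f k.
  move=> yA1 yA2.
  rewrite -(big_mkord (fun k => (- A < t k) && (t k <= y)) f).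
  rewrite (big_nat_widen _ _ _ _ _ (cutM y yA2)) [RHS](big_nat_widenl k0 0%N) //.
  apply: eq_bigl => k /=; rewrite -(bincutP s0 _ (cut0 y yA1)) ltNge.
  by rewrite -(bincutP s0 _ (cut0 (- A) (lexx _))) -leqNgt andbC.
have k0y y : - A <= y -> (k0 <= bincut M p sd y)%N.
  move=> yA; rewrite /k0 /bincut ltnS le_truncn // lerD2l ler_pM2r //.
pose c := expR (logdens M p sd k0) * sd / normal_peak 1.
have c0 : 0 < c by rewrite divr_gt0 // mulr_gt0 ?expR_gt0.
have cellsum y : - A <= y -> y <= A ->
  \sum_(k0 <= k < bincut M p sd y) gauss_cell M p sd k = Phi (t (bincut M p sd y)) - Phi (t k0).
  move=> yA1 yA2; exact: (telescope_sumr (fun k => Phi (t k)) (k0y y yA1)).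
have cell_bd k : (k0 <= k)%N -> t k <= A -> (k <= M)%N ->
  c * (expR d)^-1 * gauss_cell M p sd k <= binw M p k <= c * expR d * gauss_cell M p sd k.
  move=> kk0 tk kM.
  have cell0 : 0 <= gauss_cell M p sd k.
    by rewrite subr_ge0 Phi_mono // binstd_le.
  have kk : (k0 <= k <= M)%N by rewrite kk0.
  have tk0 : - A <= t k0 by lra.
  have [b1 b2] := binw_cell p01 s0 sd2 (ltW A0) As kk tk0 tk.
  rewrite -/c in b1 b2; apply/andP; split.
    apply: le_trans b1; rewrite ler_wpM2r // ler_pM2l // -expRN ler_expR; lra.
  apply: le_trans b2 _; rewrite ler_wpM2r // ler_pM2l // ler_expR; lra.
have midbd y : - A <= y -> y <= A -> let Q := Phi (t (bincut M p sd y)) - Phi (t k0) in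
  is_true (c * (expR d)^-1 * Q <= \sum_(k0 <= k < bincut M p sd y) binw M p k <= c * expR d * Q).
  move=> yA1 yA2 Q; rewrite /Q -cellsum // !mulr_sumr.
  have H k : (k0 <= k < bincut M p sd y)%N -> [/\ (k0 <= k)%N, t k <= A & (k <= M)%N].
    move=> /andP[k1 k2]; split=> //.
      by apply: le_trans yA2; rewrite -(bincutP s0 _ (cut0 y yA1)).
    by rewrite -ltnS (leq_trans k2) // cutM.
  by apply/andP; split; apply: ler_sum_nat => k /H [h1 h2 h3];
     have /andP[] := cell_bd k h1 h2 h3.
have tail := binw_tail p01 s0 sd2 A0; rewrite -/t in tail.
have Ad : (A ^+ 2)^-1 <= d.
  rewrite -[leRHS]invrK lef_pV2 ?posrE ?invr_gt0 ?exprn_gt0 //.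
  by apply: (le_trans AdV); rewrite expr2 ler_peMr ?(ltW A0) //; lra.
have {}tail := le_trans tail Ad.
have xA' : - A <= x <= A by rewrite -ler_norml.
have /andP[xA1 xA2] := xA'.
have bge0 k : 0 <= binw M p k by exact: binw_ge0.
pose lt := \sum_(k < M.+1 | t k <= - A) binw M p k.
have ltd : 0 <= lt <= d.
  rewrite sumr_ge0 //=; apply: le_trans tail.
  rewrite /lt big_mkcond [leRHS]big_mkcond; apply: ler_sum => k _ /=.
  case: ifP => tk; last by case: ifP.
  have {}tk : t k <= - A by [].
  by rewrite ifT // -normrN; apply: le_trans (ler_norm _); lra.
have split_sum y : - A <= y -> \sum_(k < M.+1 | t k <= y) binw M p k =
   lt + \sum_(k < M.+1 | (- A < t k) && (t k <= y)) binw M p k.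
  move=> yA; rewrite (bigID (fun k : 'I_M.+1 => t k <= - A)) /=; congr (_ + _).
    apply: eq_bigl => k; case: (lerP (t k) (- A)) => h; rewrite ?andbF ?andbT //.
    by apply/idP; exact: le_trans h yA.
  by apply: eq_bigl => k; rewrite -ltNge andbC.
rewrite -/t split_sum // window //.
pose Bw := \sum_(k0 <= k < bincut M p sd A) binw M p k.
have NAA : - A <= A by clear -A0; lra.
have Bw1 : 1 - d <= Bw <= 1.
  rewrite /Bw -window // -(sum_binw M p); apply/andP; split; last first.
    rewrite big_mkcond; apply: ler_sum => k _ /=; by case: ifP.
  rewrite lerBlDr; apply: le_trans (lerD (lexx _) tail).
  rewrite [X in _ <= X + _]big_mkcond [X in _ <= _ + X]big_mkcond -big_split.
  apply: ler_sum => k _ /=; case: ifP => [_|/negbT h].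
    by rewrite lerDl; case: ifP.
  rewrite add0r ifT //; move: h; rewrite negb_and -leNgt -ltNge => /orP[h|h].
    by rewrite -normrN; apply: le_trans (ler_norm _); rewrite lerNr.
  by apply: le_trans (ler_norm _); exact: ltW.
have mid1 : 0 <= \sum_(k0 <= k < bincut M p sd x) binw M p k <= 1.
  rewrite -window // sumr_ge0 //= -(sum_binw M p) big_mkcond.
  by apply: ler_sum => k _ /=; case: ifP.
have cx := bincut_bounds s0 (cut0 x xA1); have cA := bincut_bounds s0 (cut0 A NAA).
rewrite -/t in cx cA.
have lip y : Phi (y + sd^-1) <= Phi y + d.
  have yy : y <= y + sd^-1 by rewrite lerDl invr_ge0 ltW.
  apply: le_trans (Phi_lip yy) _; rewrite lerD2l.
  by rewrite (_ : y + sd^-1 - y = sd^-1) //; ring.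
have Pk0 : 0 <= Phi (t k0) <= 2 * d.
  rewrite Phi_ge0 /=; have : Phi (t k0) <= Phi (- A + sd^-1) by apply: Phi_mono; clear -k0b; lra.
  by move: (lip (- A)) PA1; clear; lra.
have E1 : 1 <= expR d by rewrite -expR0 ler_expR ltW.
have E2 : expR d <= 1 + 2 * d by apply: expR_le1D2x; rewrite (ltW d0) //=; clear -d20; lra.
apply: le_trans de; apply: (@clt_numeric R d (Phi x) lt _ Bw
  (Phi (t (bincut M p sd x)) - Phi (t k0))
  (Phi (t (bincut M p sd A)) - Phi (t k0)) c (expR d)) => //.
- by rewrite Phi_ge0 Phi_le1.
- exact: midbd.
- exact: midbd.
- have : Phi x <= Phi (t (bincut M p sd x)) by apply: Phi_mono; clear -cx; lra.
  have : Phi (t (bincut M p sd x)) <= Phi (x + sd^-1) by apply: Phi_mono; clear -cx; lra.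
  move: (lip x) Pk0; move: (Phi (t (bincut M p sd x))) (Phi (t k0)) (Phi x) (Phi (x + sd^-1)).
  by clear => u v w z; lra.
- have : Phi A <= Phi (t (bincut M p sd A)) by apply: Phi_mono; clear -cA; lra.
  move: (Phi_le1 (t (bincut M p sd A))) Pk0 PA2.
  by move: (Phi (t (bincut M p sd A))) (Phi (t k0)) (Phi A); clear => u v w; lra.
Qed.

(** * Log-normality when arcs are independent *)

(** Each factor is [(k/M) (1 - i/k) / (1 - i/M)]; the first-order terms of the
logarithms sum to [n(n-1)/2] times [1/M - 1/k]. *)
Lemma ln_ffratio (R : realType) (M k n : nat) : (0 < k)%N -> (k <= M)%N -> (2 * n <= k)%N ->
  `|ln (ffratio R M k n) - (n%:R * ln (k%:R / M%:R)
     - (n%:R * (n%:R - 1)) / 2 * (k%:R^-1 - M%:R^-1))|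
  <= 4 * n%:R ^+ 3 / k%:R ^+ 2.
Proof.
move=> k0 kM; have kR : (0 : R) < k%:R by rewrite ltr0n.
have MR : (0 : R) < M%:R by rewrite ltr0n (leq_trans k0).
have kMR : (k%:R : R) <= M%:R by rewrite ler_nat.
suff H b : (2 * n <= k)%N -> (b <= n)%N ->
  0 < ffratio R M k b /\
  `|ln (ffratio R M k b) - (b%:R * ln (k%:R / M%:R)
     - (b%:R * (b%:R - 1)) / 2 * (k%:R^-1 - M%:R^-1))|
  <= b%:R * (4 * n%:R ^+ 2 / k%:R ^+ 2).
  move=> nk; have [_ h] := H n nk (leqnn n); apply: le_trans h _.
  by rewrite le_eqVlt; apply/orP; left; apply/eqP; ring.
move=> nk; elim: b => [|b IHb] bn.
  by rewrite /ffratio big_ord0 ln1 !mul0r subr0 subr0 normr0.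
have [f0 h] := IHb (ltnW bn).
have bR : (b%:R : R) <= n%:R by rewrite ler_nat ltnW.
have b0 : (0 : R) <= b%:R by [].
have nkR : 2 * n%:R <= k%:R :> R by rewrite -natrM ler_nat.
have n0 : (0 : R) <= n%:R by [].
have bk : b%:R / k%:R <= 2^-1 :> R by rewrite ler_pdivrMr //; lra.
have bM : b%:R / M%:R <= b%:R / k%:R :> R.
  by rewrite ler_wpM2l // lef_pV2.
have bM0 : 0 <= b%:R / M%:R :> R by rewrite divr_ge0 // ltW.
have p1 : 0 < 1 + - (b%:R / k%:R) :> R by lra.
have p2 : 0 < 1 + - (b%:R / M%:R) :> R by lra.
have kMp : 0 < k%:R / M%:R :> R by rewrite divr_gt0.
have E : ffratio R M k b.+1 = ffratio R M k b * (k%:R / M%:R *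
    ((1 + - (b%:R / k%:R)) / (1 + - (b%:R / M%:R)))).
  rewrite /ffratio big_ord_recr /=; congr (_ * _); field.
  by rewrite !gt_eqF //; lra.
have q0 : 0 < (1 + - (b%:R / k%:R)) / (1 + - (b%:R / M%:R)) :> R by rewrite divr_gt0.
have r0 : 0 < k%:R / M%:R * ((1 + - (b%:R / k%:R)) / (1 + - (b%:R / M%:R))) :> R.
  by rewrite mulr_gt0.
split; first by rewrite E mulr_gt0.
rewrite E [ln (ffratio R M k b * _)]lnM ?posrE // [ln (_ / _ * _)]lnM ?posrE //.
rewrite [ln (_ / (1 + _))]ln_div ?posrE //.
have l1 : - 2^-1 <= - (b%:R / k%:R) :> R by lra.
have l2 : - 2^-1 <= - (b%:R / M%:R) :> R by lra.
have := ln1D_approx l1; have := ln1D_approx l2.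
have sq1 : (- (b%:R / k%:R)) ^+ 2 <= n%:R ^+ 2 / k%:R ^+ 2 :> R.
  rewrite sqrrN -expr_div_n lerXn2r ?nnegrE ?divr_ge0 ?(ltW kR) //.
  by rewrite ler_pM2r ?invr_gt0.
have sq2 : (- (b%:R / M%:R)) ^+ 2 <= n%:R ^+ 2 / k%:R ^+ 2 :> R.
  by apply: le_trans sq1; rewrite !sqrrN lerXn2r ?nnegrE // (le_trans bM0).
move=> a2 a1.
rewrite [leRHS](_ : _ = b%:R * (4 * n%:R ^+ 2 / k%:R ^+ 2) + 4 * n%:R ^+ 2 / k%:R ^+ 2); last first.
  by rewrite -natr1 mulrDl mul1r.
set L1 := ln (1 - _) in a1 *; set L2 := ln (1 - _) in a2 *.
set F := ln (ffratio R M k b) in h *; set G := ln (k%:R / M%:R) in h *.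
rewrite (_ : F + (G + (L1 - L2)) - _ =
   (F - (b%:R * G - b%:R * (b%:R - 1) / 2 * (k%:R^-1 - M%:R^-1))) +
   ((L1 - - (b%:R / k%:R)) - (L2 - - (b%:R / M%:R)))); last first.
  by rewrite -!natr1; field; rewrite !gt_eqF.
apply: le_trans (ler_normD _ _) _; apply: lerD => //.
apply: le_trans (ler_normB _ _) _.
apply: le_trans (lerD a1 a2) _.
by rewrite -!mulrA; lra.
Qed.

(** Write [k = M p (1 + th)], so [th = t beta / sqrt M].  Then [n th] is close to
[beta t] because [sqrt M] is close to [n], and as [M = n(n-1)], the second-order
term [M/2 (1/k - 1/M)] is close to [(1/p - 1)/2 = beta^2/2].  Every error is at
most a multiple of [A^2 q], where [q = 1/(n p^2)]. *)
Lemma log_mean_numeric (R : realType) (n M p sd beta t k q A : R) :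
  2 <= n -> M = n * (n - 1) -> 0 < p < 1 -> 0 < sd -> sd ^+ 2 = M * p * (1 - p) ->
  0 < beta -> beta ^+ 2 = (1 - p) / p ->
  k = M * p + t * sd -> `|t| <= A -> 1 <= A -> q = (n * p ^+ 2)^-1 -> 8 * A * q <= 1 ->
  [/\ n ^+ 2 * p / 4 <= k, 2 * n <= k &
   `|beta ^+ 2 / 2 + (n * ln (k / M) - n * (n - 1) / 2 * (k^-1 - M^-1))
     - n * ln p - beta * t| <= 12 * A ^+ 2 * q].
Proof.
move=> n2 ME /andP[p0 p1] s0 sd2 be0 be2 kE tA A1 qE Aq.
have M0 : 0 < M by rewrite ME mulr_gt0 //; lra.
pose r := Num.sqrt M.
have r0 : 0 < r by rewrite sqrtr_gt0.
have r2 : r ^+ 2 = M by rewrite sqr_sqrtr // ltW.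
have sE : sd = p * beta * r.
  have e : sd ^+ 2 = (p * beta * r) ^+ 2.
    by rewrite sd2 !exprMn r2 be2; field; rewrite gt_eqF.
  apply/eqP; rewrite -(@eqrXn2 _ 2) ?(ltW s0) //; first exact/eqP.
  by rewrite !mulr_ge0 // ltW.
have np0 : 0 < n * p ^+ 2 by rewrite mulr_gt0 ?exprn_gt0 //; lra.
have q0 : 0 < q by rewrite qE invr_gt0.
have qn : q * p ^+ 2 * n = 1 by rewrite qE; field; rewrite !gt_eqF //; lra.
have bp : beta * p <= 1.
  have : (beta * p) ^+ 2 <= 1 ^+ 2.
    by rewrite exprMn be2 expr1n expr2 mulrA divfK ?gt_eqF //; nra.
  by rewrite ler_pXn2r ?nnegrE // mulr_ge0 // ltW.
have bq : beta / n <= q * p.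
  rewrite ler_pdivrMr; last by lra.
  by rewrite -(ler_pM2r p0); nra.
have rn : r <= n.
  rewrite -(@ler_pXn2r _ 2) ?nnegrE ?(ltW r0) //; last by lra.
  by rewrite r2 ME; nra.
have nr : n <= 2 * r.
  rewrite -(@ler_pXn2r _ 2) ?nnegrE //; [|lra|lra].
  by rewrite exprMn r2 ME; nra.
pose th := t * beta / r.
have kE' : k = M * p * (1 + th).
  by rewrite kE sE /th -r2; field; rewrite gt_eqF.
have be_r : beta / r <= 2 * (q * p).
  rewrite ler_pdivrMr //; rewrite ler_pdivrMr in bq; last by lra.
  have : q * p * n <= q * p * (2 * r) by rewrite ler_pM2l ?mulr_gt0.
  by nra.
have be_r0 : 0 <= beta / r by rewrite divr_ge0 // ltW.
have thA : `|th| <= 2 * A * (q * p).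
  rewrite /th -mulrA normrM (ger0_norm be_r0).
  have : `|t| * (beta / r) <= A * (2 * (q * p)) by apply: ler_pM.
  by lra.
have qp : 0 < q * p by rewrite mulr_gt0.
have qpq : q * p <= q by rewrite ler_piMr // ltW.
have th4 : `|th| <= 4^-1.
  have : 2 * A * (q * p) <= 2 * A * q by rewrite ler_wpM2l //; lra.
  by lra.
have th4' : - 4^-1 <= th <= 4^-1 by rewrite -ler_norml.
have Mn : n ^+ 2 / 2 <= M by rewrite ME; nra.
have k4 : n ^+ 2 * p / 4 <= k.
  rewrite kE'.
  have h1 : n ^+ 2 / 2 * p <= M * p by rewrite ler_pM2r.
  have h2 : M * p * (1 / 2) <= M * p * (1 + th).
    by rewrite ler_pM2l ?mulr_gt0 //; lra.
  by move: h1 h2; clear; lra.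
have q8 : 8 * q <= 1 by nra.
have np8 : 8 <= n * p.
  have h1 : 8 <= n * p ^+ 2.
    by rewrite -(ler_pM2l q0); lra.
  apply: le_trans h1 _; rewrite ler_wpM2l //; [lra|].
  by rewrite expr2 ler_piMr ?ltW.
have k2 : 2 * n <= k.
  by apply: le_trans k4; clear -np8 n2; nra.
split=> //.
have kM : k / M = p * (1 + th) by rewrite kE'; field; rewrite gt_eqF.
have k_0 : 0 < k by clear -k2 n2; lra.
have th1 : 0 < 1 + th by clear -th4'; lra.
rewrite kM lnM ?posrE //.
have l1 : - 2^-1 <= th by clear -th4'; lra.
have := ln1D_approx l1; set L := ln (1 + th) => hL.
have -> : beta ^+ 2 / 2 + (n * (ln p + L) - n * (n - 1) / 2 * (k^-1 - M^-1)) - n * ln p - beta * t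
   = n * (L - th) + beta * t * (n / r - 1) + th / (2 * p * (1 + th)).
  rewrite be2 -ME (_ : M / 2 * (k^-1 - M^-1) = (2 * p * (1 + th))^-1 - 2^-1); last first.
    by rewrite kE'; field; rewrite !gt_eqF.
  rewrite [n * (L - th)](_ : _ = n * L - t * beta * (n / r)); last first.
    by rewrite /th; field; rewrite gt_eqF.
  by field; rewrite !gt_eqF.
apply: le_trans (ler_normD _ _) _.
apply: le_trans (lerD (ler_normD _ _) (lexx _)) _.
have n0 : 0 < n by clear -n2; lra.
have e1 : `|n * (L - th)| <= 8 * A ^+ 2 * q.
  rewrite normrM gtr0_norm //.
  have : n * `|L - th| <= n * (2 * th ^+ 2) by rewrite ler_pM2l.
  have : th ^+ 2 <= (2 * A * (q * p)) ^+ 2.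
    by rewrite -(real_normK (num_real th)) lerXn2r ?nnegrE ?mulr_ge0 ?(ltW qp) //;
       clear -A1 q0 p0; lra.
  have -> : (2 * A * (q * p)) ^+ 2 = 4 * A ^+ 2 * q * (q * p ^+ 2) by ring.
  move=> h1 h2; apply: le_trans h2 _.
  have : n * (2 * th ^+ 2) <= n * (2 * (4 * A ^+ 2 * q * (q * p ^+ 2))).
    by rewrite !ler_pM2l.
  move=> h3; apply: le_trans h3 _.
  by rewrite (_ : n * _ = 8 * A ^+ 2 * q * (q * p ^+ 2 * n)); [rewrite qn mulr1|ring].
have e2 : `|beta * t * (n / r - 1)| <= 2 * A * q.
  have -> : beta * t * (n / r - 1) = t * (beta / r * (n - r)) by field; rewrite gt_eqF.
  have w0 : 0 <= beta / r * (n - r) by rewrite mulr_ge0 // subr_ge0.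
  rewrite normrM (ger0_norm w0).
  have nr1 : n - r <= 1.
    have : (n - 1) <= r.
      rewrite -(@ler_pXn2r _ 2) ?nnegrE ?(ltW r0) //; last by clear -n2; lra.
      by rewrite r2 ME; clear -n2; nra.
    by clear; lra.
  have h : beta / r * (n - r) <= 2 * q.
    have : beta / r * (n - r) <= beta / r * 1 by rewrite ler_wpM2l.
    by lra.
  have : `|t| * (beta / r * (n - r)) <= A * (2 * q).
    by apply: ler_pM => //; rewrite mulr_ge0 // subr_ge0.
  by lra.
have e3 : `|th / (2 * p * (1 + th))| <= 2 * A * q.
  rewrite normrM (gtr0_norm (x := (_)^-1)); last first.
    by rewrite invr_gt0 !mulr_gt0.
  rewrite ler_pdivrMr ?mulr_gt0 //.
  apply: le_trans thA _.
  rewrite (_ : 2 * A * q * _ = 2 * A * (q * p) * (2 * (1 + th))); last by ring.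
  by rewrite ler_peMr ?mulr_ge0 ?(ltW qp) //; clear -A1 q0 p0 th4'; lra.
have AA : 4 * A * q <= 4 * A ^+ 2 * q.
  by rewrite ler_pM2r // expr2; clear -A1; nra.
by apply: le_trans (lerD (lerD e1 e2) e3) _; clear -AA; lra.
Qed.

Definition logcount (R : realType) (n : nat) (p : R) (D : digraph n) : \bar R :=
  let X (D : digraph n) : R := (num_dhamcycles D)%:R in
  let beta : R := Num.sqrt ((1 - p) / p) in
  (lne (expR (beta ^+ 2 / 2) * X D / Expect (Dnp n p) X)%:E * (beta^-1)%:E)%E.

(** If [k] arcs are present and the count is within a factor [1 +- eta] of its mean for
that number of arcs, then the normalised logarithm is nearly the standardised
number of arcs.  The division by [beta >= sqrt (1 - c)] is where [p <= c < 1]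
is needed. *)
Lemma logcount_approx (R : realType) (n : nat) (p c delta A eta : R) (k : nat)
    (D : digraph n) (sd q : R) :
  let M := #|darc n| in
  let X (D : digraph n) : R := (num_dhamcycles D)%:R in
  (2 <= n)%N ->
  0 < p < 1 -> p <= c -> c < 1 -> 0 < sd -> sd ^+ 2 = M%:R * p * (1 - p) ->
  q = (n%:R * p ^+ 2)^-1 -> 1 <= A -> 8 * A * q <= 1 ->
  0 < eta -> eta <= 2^-1 ->
  2 * eta + 76 * A ^+ 2 * q <= delta * Num.sqrt (1 - c) ->
  (k <= M)%N -> `|binstd M p sd k| <= A ->
  `|X D / Expect (Dnm R n k) X - 1| <= eta ->
  exists2 y : R, logcount p D = y%:E & `|y - binstd M p sd k| <= delta.
Proof.
move=> M X n2 p01 pc c1 s0 sd2 qE A1 Aq e0 e2 small kM tA hX.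
have /andP[p0 p1] := p01.
pose beta : R := Num.sqrt ((1 - p) / p); pose lambda : R := Expect (Dnp n p) X.
have n1 : (1 < n)%N := n2.
have nR : 2 <= n%:R :> R by rewrite ler_nat.
have ME : M%:R = n%:R * (n%:R - 1) :> R.
  by rewrite /M card_darc natrM -subn1 natrB // ltnW.
have be2p : 0 < (1 - p) / p by rewrite divr_gt0 // subr_gt0.
have be0 : 0 < beta by rewrite sqrtr_gt0.
have be2 : beta ^+ 2 = (1 - p) / p by rewrite sqr_sqrtr // ltW.
have [k4 k2 main] := log_mean_numeric nR ME p01 s0 sd2 be0 be2
  (binstdK M p s0 k) tA A1 qE Aq.
set t := binstd M p sd k in tA main *.
have k2' : (2 * n <= k)%N by rewrite -(ler_nat R) natrM.
have k0 : (0 < k)%N by apply: leq_trans k2'; rewrite mul2n double_gt0 ltnW.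
have lnff := ln_ffratio R k0 kM k2'.
pose Z : R := n%:R * ln (k%:R / M%:R)
  - n%:R * (n%:R - 1) / 2 * (k%:R^-1 - M%:R^-1).
rewrite -/Z in main lnff.
have k0R : (0 : R) < k%:R by rewrite ltr0n.
have n0R : (0 : R) < n%:R by lra.
have q0 : 0 < q by rewrite qE invr_gt0 mulr_gt0 ?exprn_gt0.
have qn : q * n%:R * p ^+ 2 = 1 by rewrite qE; field; rewrite !gt_eqF.
have cubic : 4 * n%:R ^+ 3 / k%:R ^+ 2 <= 64 * q.
  rewrite ler_pdivrMr ?exprn_gt0 //.
  have : (n%:R ^+ 2 * p / 4) ^+ 2 <= k%:R ^+ 2 :> R.
    by rewrite lerXn2r ?nnegrE ?mulr_ge0 ?sqr_ge0 ?(ltW p0).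
  rewrite -(ler_pM2l q0) => h.
  rewrite -mulrA; apply: le_trans (ler_wpM2l _ h); last by [].
  rewrite (_ : 64 * _ = 4 * n%:R ^+ 3 * (q * n%:R * p ^+ 2)); last by field.
  by rewrite qn mulr1.
have ff0 : 0 < ffratio R M k n.
  apply: prodr_gt0 => i _.
  have iR : (i%:R : R) < n%:R by rewrite ltr_nat.
  have kMR : (k%:R : R) <= M%:R by rewrite ler_nat.
  by apply: divr_gt0; move: iR kMR k2 n0R; clear; lra.
pose h : R := #|[set H : digraph n | dhamcycle H]|%:R.
have h0 : 0 < h := num_ham_gt0 R n1.
have muE : Expect (Dnm R n k) X = h * ffratio R M k n := @Expect_Dnm R n k kM.
have laE : lambda = h * p ^+ n := @Expect_Dnp R n p.
set mu := Expect _ _ in hX muE.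
have mu0 : 0 < mu by rewrite muE mulr_gt0.
pose u := X D / mu - 1.
have hu : `|u| <= eta := hX.
have XE : X D = mu * (1 + u) by rewrite /u addrC subrK mulrC divfK ?gt_eqF.
have /andP[u1 u2] : - eta <= u <= eta by rewrite -ler_norml.
have u0 : 0 < 1 + u by move: u1 e2; clear; lra.
have pn0 : 0 < p ^+ n by rewrite exprn_gt0.
have ratioE : expR (beta ^+ 2 / 2) * X D / lambda =
    expR (beta ^+ 2 / 2) * ((1 + u) * (ffratio R M k n / p ^+ n)).
  by rewrite XE laE muE; field; rewrite !gt_eqF.
have fp0 : 0 < ffratio R M k n / p ^+ n by rewrite divr_gt0.
have v0 : 0 < (1 + u) * (ffratio R M k n / p ^+ n) by rewrite mulr_gt0.
exists (ln (expR (beta ^+ 2 / 2) * X D / lambda) / beta).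
  rewrite /logcount -/X -/lambda -/beta lne_EFin // ratioE mulr_gt0 ?expR_gt0 //.
rewrite ratioE [ln (expR _ * _)]lnM ?posrE ?expR_gt0 // expRK.
rewrite [ln ((1 + u) * _)]lnM ?posrE // [ln (_ / p ^+ n)]ln_div ?posrE //.
rewrite lnXn // -[ln p *+ n]mulr_natl.
have l1 : - 2^-1 <= u by move: u1 e2; clear; lra.
have lnu := ln1D_approx l1.
have u_sq : 2 * u ^+ 2 <= eta.
  have : u ^+ 2 <= eta ^+ 2.
    by rewrite -(real_normK (num_real u)) lerXn2r ?nnegrE // (le_trans (normr_ge0 u)).
  by move: e0 e2; rewrite !expr2; clear; nra.
set L := ln (ffratio R M k n) in lnff *; set Lp := ln p in main *.
set Lu := ln (1 + u) in lnu *.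
have A2 : 1 <= A ^+ 2 by rewrite expr_ge1 // (le_trans ler01).
have qA : q <= A ^+ 2 * q by rewrite ler_peMl // ltW.
have tot : `|beta ^+ 2 / 2 + (Lu + (L - n%:R * Lp)) - beta * t| <= delta * Num.sqrt (1 - c).
  apply: le_trans small; move: main lnff cubic lnu u_sq u1 u2 qA.
  rewrite !ler_norml.
  move: (beta ^+ 2 / 2) (beta * t) (n%:R * Lp) (4 * _ / _) (u ^+ 2) => b2 bt w z v; clear.
  move=> /andP[? ?] /andP[? ?] ? /andP[? ?] ? ? ? ?.
  by apply/andP; split; lra.
have d0 : 0 <= delta.
  have c0 : 0 < Num.sqrt (1 - c) by rewrite sqrtr_gt0 subr_gt0.
  by rewrite -(pmulr_lge0 _ c0); apply: le_trans tot.
have cb : Num.sqrt (1 - c) <= beta.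
  rewrite ler_wsqrtr // ler_pdivlMr //.
  have : (1 - c) * p <= (1 - p) * 1.
    by apply: ler_pM; rewrite ?subr_ge0 ?(ltW c1) ?(ltW p0) ?(ltW p1) // lerD2l lerN2.
  by rewrite mulr1.
rewrite -(ler_pM2r be0) -[X in _ * X](gtr0_norm be0) -normrM mulrBl divfK ?gt_eqF //.
rewrite (mulrC t); apply: le_trans tot _.
by rewrite ler_wpM2l.
Qed.

Lemma Prob_le_split (R : realType) (T : finType) (w : T -> R) (P E B : pred T) :
  (forall t, 0 <= w t) -> \sum_t w t = 1 -> (forall t, P t -> E t || B t) ->
  Prob w P <= Prob w E + Prob w B.
Proof.
move=> w0 w1 PEB; rewrite /Prob (big_mkcond P) (big_mkcond E) (big_mkcond B) -big_split /=.
apply: ler_sum => t _; have := PEB t; have := w0 t.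
by case: (P t); case: (E t); case: (B t) => //= ? h;
   rewrite ?addr0 ?add0r ?lerDl ?addr_ge0 //; have := h isT.
Qed.

(** For every [k] in the window of standardised values at most [A] in size, the normalised
logarithm is within [delta] of its standardised value, except on an event of conditional
probability [delta]; outside the window Chebyshev suffices.
So its distribution function lies between those of the standardised
binomial variable at [x - delta] and [x + delta], up to [2 delta]. *)
Theorem normal_approx (R : realType) (c x delta : R) : c < 1 -> 0 < delta ->
  exists2 q0 : R, 0 < q0 & forall (n : nat) (p : R), (2 <= n)%N -> 0 < p < 1 -> p <= c ->
  (n%:R * p ^+ 2)^-1 <= q0 ->
  `|Prob (Dnp n p) (fun D => (logcount p D <= x%:E)%E) - Phi x| <=
    (3 + normal_peak 1) * delta.
Proof.
move=> c1 d0.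
pose A : R := 1 + delta^-1.
have dV0 : 0 < delta^-1 by rewrite invr_gt0.
have A1 : 1 <= A by rewrite lerDl ltW.
have A0 : 0 < A by rewrite (lt_le_trans ltr01).
have Ad : (A ^+ 2)^-1 <= delta.
  rewrite -[leRHS]invrK lef_pV2 ?posrE ?exprn_gt0 //.
  apply: (@le_trans _ _ A); first by rewrite lerDr.
  by rewrite expr2 ler_peMl // ltW.
pose b0 := Num.sqrt (1 - c).
have b00 : 0 < b0 by rewrite sqrtr_gt0 subr_gt0.
have b02 : b0 ^+ 2 = 1 - c by rewrite sqr_sqrtr // subr_ge0 ltW.
have db0 : 0 < delta * b0 by rewrite mulr_gt0.
pose eta := Num.min 2^-1 (Num.min delta (delta * b0 / 4)).
have eta0 : 0 < eta by rewrite !lt_min invr_gt0 ltr0n d0 divr_gt0.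
have eta2 : eta <= 2^-1 by rewrite ge_min lexx.
have etad : eta <= delta by rewrite !ge_min lexx !orbT.
have etab : eta <= delta * b0 / 4 by rewrite !ge_min lexx !orbT.
clearbody eta b0.
have [C C0 conc] := concentration eta0.
have [S1 S10 clt1] := binomial_clt (x + delta) d0.
have [S2 S20 clt2] := binomial_clt (x - delta) d0.
pose S := S1 + S2.
have S0 : 0 < S by rewrite addr_gt0.
(* For [q <= 1 / (T1 + T2 + T3 + T4)]: [T1] keeps [th] small in
   [log_mean_numeric], [T2] gives [C n^3 <= k^2], [T3] makes the error of
   [logcount_approx] at most [delta], and [T4] makes the variance large. *)
pose T1 := 8 * A; pose T2 := 16 * C; pose T3 := 152 * A ^+ 2 / (delta * b0).
pose T4 := 2 * S ^+ 2 / b0 ^+ 2.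
have T10 : 0 < T1 by rewrite mulr_gt0.
have T20 : 0 < T2 by rewrite mulr_gt0.
have T30 : 0 < T3.
  by apply: divr_gt0 => //; apply: mulr_gt0; [exact: ltr0Sn | exact: exprn_gt0].
have T40 : 0 < T4 by rewrite divr_gt0 ?mulr_gt0 // exprn_gt0.
have Ts0 : 0 < T1 + T2 + T3 + T4 by rewrite !addr_gt0.
exists (T1 + T2 + T3 + T4)^-1; first by rewrite invr_gt0.
move=> n p n2 p01 pc; have /andP[p0 p1] := p01.
set q := (n%:R * p ^+ 2)^-1 => hq.
have nR : 2 <= n%:R :> R by rewrite ler_nat.
have n0R : 0 < n%:R :> R by rewrite (lt_le_trans _ nR).
have np0 : 0 < n%:R * p ^+ 2 by rewrite mulr_gt0 ?exprn_gt0.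
have q0 : 0 < q by rewrite invr_gt0.
have qT T : T <= T1 + T2 + T3 + T4 -> T * q <= 1.
  move=> TT; rewrite -(@mulfV _ (T1 + T2 + T3 + T4)) ?gt_eqF //.
  apply: (@le_trans _ _ ((T1 + T2 + T3 + T4) * q)); first by rewrite ler_pM2r.
  by rewrite ler_pM2l.
have q1 : T1 * q <= 1 by apply: qT; move: T10 T20 T30 T40; clear; lra.
have q2 : T2 * q <= 1 by apply: qT; move: T10 T20 T30 T40; clear; lra.
have q3 : T3 * q <= 1 by apply: qT; move: T10 T20 T30 T40; clear; lra.
have q4 : T4 * q <= 1 by apply: qT; move: T10 T20 T30 T40; clear; lra.
have qn : n%:R * p ^+ 2 * q = 1 by rewrite mulfV ?gt_eqF.
pose M := #|darc n|.
have ME : M%:R = n%:R * (n%:R - 1) :> R.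
  by rewrite /M card_darc natrM -subn1 natrB //; exact: ltnW.
have Mn : n%:R ^+ 2 / 2 <= M%:R :> R by rewrite ME; move: nR; clear; nra.
have M0 : 0 < M%:R :> R by apply: lt_le_trans Mn; rewrite divr_gt0 ?exprn_gt0.
have var0 : 0 < M%:R * p * (1 - p) by rewrite !mulr_gt0 // subr_gt0.
pose sd := Num.sqrt (M%:R * p * (1 - p)).
have s0 : 0 < sd by rewrite sqrtr_gt0.
have sd2 : sd ^+ 2 = M%:R * p * (1 - p) by rewrite sqr_sqrtr // ltW.
have Ssd : S <= sd.
  rewrite -(@ler_pXn2r _ 2) ?nnegrE ?(ltW s0) ?(ltW S0) // sd2.
  have h1 : 2 * S ^+ 2 * q <= b0 ^+ 2.
    rewrite -[leRHS]mul1r -ler_pdivrMr ?exprn_gt0 //.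
    by move: q4; rewrite /T4 mulrAC.
  have h2 : n%:R ^+ 2 / 2 * p * b0 ^+ 2 <= M%:R * p * (1 - p).
    rewrite b02; apply: ler_pM.
    - by rewrite !mulr_ge0 ?(ltW p0) ?sqr_ge0.
    - by rewrite subr_ge0 ltW.
    - by rewrite ler_pM2r.
    - by rewrite lerD2l lerN2.
  apply: le_trans h2.
  have h3 : n%:R * p ^+ 2 * (2 * S ^+ 2 * q) <= n%:R * p ^+ 2 * b0 ^+ 2 by rewrite ler_pM2l.
  have h4 : n%:R * p ^+ 2 * (2 * S ^+ 2 * q) = 2 * S ^+ 2.
    by rewrite [LHS](_ : _ = 2 * S ^+ 2 * (n%:R * p ^+ 2 * q)); [rewrite qn mulr1|ring].
  rewrite h4 in h3.
  have h5 : n%:R * p ^+ 2 * b0 ^+ 2 <= n%:R ^+ 2 * p * b0 ^+ 2.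
    rewrite ler_pM2r ?exprn_gt0 // !expr2 mulrA ler_pM2r //.
    rewrite ler_pM2l //; by apply: (le_trans (ltW p1)); rewrite (le_trans _ nR) // ler1n.
  by move: h3 h5; set a := n%:R ^+ 2 * p * b0 ^+ 2;
     rewrite (_ : n%:R ^+ 2 / 2 * p * b0 ^+ 2 = a / 2); [clear; lra | rewrite /a; field].
pose t := binstd M p sd.
pose b k := binw M p k.
have p01' : 0 <= p <= 1 by rewrite !ltW.
have bge0 k : 0 <= b k by exact: binw_ge0.
have bsum : \sum_(k < M.+1) b k = 1 by exact: sum_binw.
have tail : \sum_(k < M.+1 | A <= `|t k|) b k <= delta.
  by apply: le_trans Ad; exact: binw_tail.
pose Y := fun D : digraph n => (logcount p D <= x%:E)%E.
have small : 2 * eta + 76 * A ^+ 2 * q <= delta * Num.sqrt (1 - c).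
  have sq : Num.sqrt (1 - c) = b0 by rewrite -b02 sqrtr_sqr gtr0_norm.
  have : 152 * A ^+ 2 * q <= delta * b0.
    rewrite -[leRHS]mul1r -ler_pdivrMr //.
    by move: q3; rewrite /T3 mulrAC.
  rewrite sq; move: etab; move: (delta * b0) => a.
  by clear; lra.
pose bad k := fun D : digraph n =>
  eta < `|(num_dhamcycles D)%:R / Expect (Dnm R n k) (fun D => (num_dhamcycles D)%:R) - 1|.
have window k : (k <= M)%N -> `|t k| <= A ->
    Prob (Dnm R n k) (bad k) <= delta /\
    (forall D, ~~ bad k D -> exists2 y : R, logcount p D = y%:E & `|y - t k| <= delta).
  move=> kM tA.
  have be2p : 0 < (1 - p) / p by rewrite divr_gt0 // subr_gt0.
  have be0 : 0 < Num.sqrt ((1 - p) / p) by rewrite sqrtr_gt0.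
  have [k4 k2 _] := log_mean_numeric nR ME p01 s0 sd2
    be0 (sqr_sqrtr (ltW be2p)) (binstdK M p s0 k) tA A1
    (erefl q) q1.
  split; last first.
    move=> D; rewrite -leNgt => hD.
    exact: (logcount_approx n2 p01 pc c1 s0 sd2 (erefl q) A1 q1 eta0 eta2 small kM tA hD).
  have k0 : (0 < k)%N by rewrite -(ltr_nat R); apply: lt_le_trans k2; rewrite mulr_gt0.
  have h : C * n%:R ^+ 3 <= k%:R ^+ 2.
    have h1 : (n%:R ^+ 2 * p / 4) ^+ 2 <= k%:R ^+ 2 :> R.
      by rewrite lerXn2r ?nnegrE ?mulr_ge0 ?sqr_ge0 ?(ltW p0).
    apply: le_trans h1; rewrite -(ler_pM2r q0).
    rewrite [leRHS](_ : _ = n%:R ^+ 3 / 16 * (n%:R * p ^+ 2 * q)); last by field.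
    rewrite qn mulr1 ler_pdivlMr // (_ : _ * 16 = n%:R ^+ 3 * (T2 * q)); last first.
      by rewrite /T2; ring.
    by rewrite ler_piMr ?exprn_ge0.
  have k0M : (0 < k <= M)%N by rewrite k0.
  by have [_ hP] := conc n k n2 k0M h; apply: le_trans hP etad.
have Pk0 k E : 0 <= Prob (Dnm R n k) E by apply: Prob_ge0 => D; exact: Dnm_ge0.
have Pk1 k E : (k <= M)%N -> Prob (Dnm R n k) E <= 1.
  by move=> kM; apply: Prob_le1 => [D|]; [exact: Dnm_ge0 | exact: Dnm_sum1].
have upper : Prob (Dnp n p) Y <= \sum_(k < M.+1 | t k <= x + delta) b k + 2 * delta.
  rewrite Prob_mixture.
  have -> : 2 * delta = delta * \sum_(k < M.+1) b k + delta by rewrite bsum; ring.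
  rewrite addrA; apply: le_trans (lerD (lexx _) tail).
  rewrite mulr_sumr [X in _ <= X + _ + _]big_mkcond [X in _ <= _ + _ + X]big_mkcond.
  rewrite -!big_split /=; apply: ler_sum => k _; rewrite -/(b k).
  have kM : (k <= M)%N by rewrite -ltnS.
  have db : 0 <= delta * b k by rewrite mulr_ge0 // ltW.
  case: (lerP A `|t k|) => tA.
    apply: (@le_trans _ _ (b k)); first by rewrite ler_piMr // Pk1.
    by rewrite lerDr addr_ge0 //; case: ifP.
  have [badk goodk] := window k kM (ltW tA).
  rewrite addr0; case: (lerP (t k) (x + delta)) => tx.
    by rewrite -[leLHS]addr0 lerD // ler_piMr // Pk1.
  rewrite add0r mulrC ler_wpM2r //; apply: le_trans badk.
  apply: Prob_mono => [D|D]; first exact: Dnm_ge0.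
  rewrite !unfold_in /= => YD; apply/negPn/negP => /goodk [y Dy ty].
  move: YD; rewrite /Y Dy lee_fin => yx.
  by move: ty; rewrite ler_norml => /andP[ty _]; move: ty tx yx; clear; lra.
have lower : \sum_(k < M.+1 | t k <= x - delta) b k <= Prob (Dnp n p) Y + 2 * delta.
  rewrite Prob_mixture.
  have -> : 2 * delta = delta * \sum_(k < M.+1) b k + delta by rewrite bsum; ring.
  rewrite addrA; apply: le_trans (lerD (lexx _) tail).
  rewrite mulr_sumr [leLHS]big_mkcond [X in _ <= _ + _ + X]big_mkcond.
  rewrite -!big_split /=; apply: ler_sum => k _; rewrite -/(b k).
  have kM : (k <= M)%N by rewrite -ltnS.
  have db : 0 <= delta * b k by rewrite mulr_ge0 // ltW.
  have bP : 0 <= b k * Prob (Dnm R n k) Y by rewrite mulr_ge0.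
  case: (lerP A `|t k|) => tA.
    by case: ifP => _; rewrite ?lerDr ?addr_ge0.
  have [badk goodk] := window k kM (ltW tA).
  rewrite addr0; case: (lerP (t k) (x - delta)) => tx; last by rewrite addr_ge0.
  rewrite (mulrC delta) -mulrDr -[leLHS]mulr1 ler_wpM2l //.
  rewrite -(@Dnm_sum1 R n k kM); apply: le_trans (lerD (lexx _) badk).
  apply: (@Prob_le_split _ _ _ predT) => [D||D _]; [exact: Dnm_ge0|exact: Dnm_sum1|].
  rewrite orbC; case: (boolP (bad k D)) => //= /goodk [y Dy ty].
  rewrite /Y Dy lee_fin.
  by move: ty; rewrite ler_norml => /andP[_ ty]; move: ty tx; clear; lra.
have := clt1 M p sd p01 (le_trans _ Ssd) sd2; have := clt2 M p sd p01 (le_trans _ Ssd) sd2.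
rewrite !ler_norml -/t -/b => /(_ ltac:(by rewrite lerDr ltW)) /andP[c2 _].
move=> /(_ ltac:(by rewrite lerDl ltW)) /andP[_ c3].
have l1 : Phi (x + delta) <= Phi x + normal_peak 1 * delta.
  have xx : x <= x + delta by rewrite lerDl ltW.
  by apply: le_trans (Phi_lip xx) _; rewrite addrAC subrr add0r.
have l2 : Phi x <= Phi (x - delta) + normal_peak 1 * delta.
  have xx : x - delta <= x by rewrite gerBl ltW.
  by apply: le_trans (Phi_lip xx) _; rewrite (_ : x - (x - delta) = delta) //; ring.
move: upper lower c2 c3 l1 l2; set B1 := \sum_(k < _ | _) _; set B2 := \sum_(k < _ | _) _.
rewrite [(3 + _) * _]mulrDl; set N := normal_peak 1 * delta; set P := Prob _ _.
move: (Phi _) (Phi _) (Phi _) => F1 F2 F3; clearbody B1 B2 N P; clear.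
by move=> *; apply/andP; split; lra.
Qed.

(** * Limits along the sequence *)

Local Open Scope classical_set_scope.
Local Open Scope ring_scope.

Lemma near_limn_sup (R : realType) (u : nat -> R) (l : R) :
  has_ubound (range u) -> has_lbound (range u) -> limn_sup u < l ->
  exists2 c, c < l & \forall n \near \oo, u n <= c.
Proof.
move=> ub lb; rewrite /limn_sup (cvg_lim _ (cvg_sups_inf ub lb)) // => ll.
have [|_ [N _ <-] Nl] := inf_lt _ ll; first by exists (sups u 0%N); exists 0%N.
exists (sups u N) => //; exists N => // k /= Nk.
by apply: ub_le_sup; [exact: has_ubound_sdrop | exists k].
Qed.

(** The growth condition squared: [1/(n p^2)], which bounds every error term, tends to
zero. *)
Lemma sparse_near (R : realType) (p : nat -> R) :
  (forall n, (2 <= n)%N -> 0 < p n < 1) ->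
  (fun n : nat => n%:R `^ (- 2^-1) : R^o) =o_\oo (p : nat -> R^o) ->
  forall Q : R, 0 < Q ->
  \forall n \near \oo, (2 <= n)%N /\ (n%:R * p n ^+ 2)^-1 <= Q.
Proof.
move=> hp /eqoP hpn Q Q0.
have sQ : 0 < Num.sqrt Q by rewrite sqrtr_gt0.
near=> n.
have n2 : (2 <= n)%N by near: n; exists 2%N.
split => //; have /andP[p0 p1] := hp n n2.
have h : `|n%:R `^ (- 2^-1) : R| <= Num.sqrt Q * `|p n|.
  by near: n; exact: (hpn _ sQ).
have n0 : 0 < n%:R :> R by rewrite ltr0n ltnW.
rewrite invfM ler_pdivrMr ?exprn_gt0 //.
have -> : n%:R^-1 = (n%:R `^ (- 2^-1)) ^+ 2 :> R.
  rewrite -powR_mulrn ?powR_ge0 // -powRrM -powR_inv1 ?ltW //; congr (_ `^ _).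
  by field.
rewrite -(sqr_sqrtr (ltW Q0)) -exprMn.
rewrite lerXn2r ?nnegrE ?powR_ge0 ?mulr_ge0 ?(ltW sQ) ?(ltW p0) //.
by move: h; rewrite ger0_norm ?powR_ge0 // gtr0_norm.
Unshelve. all: by end_near. Qed.

Lemma card_darc_bin n : (2 * 'C(n, 2))%N = #|darc n|.
Proof. by rewrite card_darc -(mul_bin_diag n 1) bin1. Qed.

Theorem theorem9 (R : realType) (p : nat -> R) (m : nat -> nat)
  (hp : forall n, (2 <= n)%N -> 0 < p n < 1)
  (hm : forall n, (2 <= n)%N -> (0 < m n < 2 * 'C(n, 2))%N)
  (hmp : forall n, (2 <= n)%N -> (m n)%:R = 2 * p n * 'C(n, 2)%:R)
  (hpn : (fun n : nat => n%:R `^ (- 2^-1) : R^o) =o_\oo (p : nat -> R^o)) :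
  let X (n : nat) (D : digraph n) : R := (num_dhamcycles D)%:R in
  let mu (n : nat) : R := Expect (Dnm R n (m n)) (X n) in
  let lambda (n : nat) : R := Expect (Dnp n (p n)) (X n) in
  let beta (n : nat) : R := Num.sqrt ((1 - p n) / p n) in
  cvg_in_prob (fun n => Dnm R n (m n)) (fun n D => X n D / mu n) 1
  /\ (limn_sup p < 1 ->
      cvg_in_dist (fun n => Dnp n (p n))
        (fun n D =>
           (lne (expR (beta n ^+ 2 / 2) * X n D / lambda n)%:E
              * ((beta n)^-1)%:E)%E)
        (normal_prob 0 1 : probability _ R)).
Proof.
move=> X mu lambda beta; split.
  move=> eps eps0; apply/cvgrPdist_le => e e0.
  pose d := Num.min eps e.
  have d0 : 0 < d by rewrite lt_min eps0.
  have [C C0 conc] := concentration d0.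
  have C40 : 0 < (4 * C)^-1 by rewrite invr_gt0 mulr_gt0.
  near=> n.
  have [n2 hq] : (2 <= n)%N /\ (n%:R * p n ^+ 2)^-1 <= (4 * C)^-1.
    by near: n; exact: sparse_near.
  have /andP[p0 p1] := hp n n2.
  have mM : (0 < m n <= #|darc n|)%N.
    by have /andP[-> /ltnW] := hm n n2; rewrite card_darc_bin.
  have nR : 2 <= n%:R :> R by rewrite ler_nat.
  have n0 : 0 < n%:R :> R by rewrite (lt_le_trans _ nR).
  have mE : (m n)%:R = p n * (n%:R * (n%:R - 1)) :> R.
    rewrite hmp // mulrAC -[2 in LHS]/(2%:R) -natrM card_darc_bin card_darc mulrC.
    by rewrite natrM -subn1 natrB //; exact: ltnW.
  have h : C * n%:R ^+ 3 <= (m n)%:R ^+ 2.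
    move: hq; rewrite lef_pV2 ?posrE ?mulr_gt0 ?exprn_gt0 // => hq.
    have h1 : (p n * (n%:R ^+ 2 / 2)) ^+ 2 <= (m n)%:R ^+ 2.
      rewrite mE lerXn2r ?nnegrE ?mulr_ge0 ?sqr_ge0 ?(ltW p0) //.
        by rewrite subr_ge0 (le_trans _ nR) // ler1n.
      by rewrite ler_pM2l //; move: nR; clear; nra.
    apply: le_trans h1.
    rewrite [leRHS](_ : _ = n%:R * p n ^+ 2 / 4 * n%:R ^+ 3); last by field.
    by rewrite ler_pM2r ?exprn_gt0 // ler_pdivlMr // mulrC.
  have [_ hP] := conc n (m n) n2 mM h.
  have Pge0 E : 0 <= Prob (Dnm R n (m n)) E by apply: Prob_ge0 => D; exact: Dnm_ge0.
  rewrite sub0r normrN ger0_norm //.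
  apply: (@le_trans _ _ d); last by rewrite ge_min lexx orbT.
  apply: le_trans hP; apply: Prob_mono => [D|D]; first exact: Dnm_ge0.
  rewrite !unfold_in; apply: le_lt_trans.
  by rewrite ge_min lexx.
move=> lsup F x _; apply/cvgrPdist_le => e e0.
have pb : has_ubound (range p) /\ has_lbound (range p).
  have pbd n : - (1 + `|p 0%N| + `|p 1%N|) <= p n <= 1 + `|p 0%N| + `|p 1%N|.
    rewrite -ler_norml; case: n => [|[|n]].
    - by have := normr_ge0 (p 1%N); lra.
    - by have := normr_ge0 (p 0%N); lra.
    have /andP[p0 p1] := hp n.+2 isT; rewrite gtr0_norm //.
    by have := normr_ge0 (p 0%N); have := normr_ge0 (p 1%N); lra.
  by split; [exists (1 + `|p 0%N| + `|p 1%N|) | exists (- (1 + `|p 0%N| + `|p 1%N|))];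
     move=> _ [n _ <-]; have /andP[] := pbd n.
have [c c1 pc] := near_limn_sup pb.1 pb.2 lsup.
have K0 : 0 < 3 + normal_peak 1 :> R by rewrite addr_gt0 ?normal_peak1_gt0.
have d0 : 0 < e / (3 + normal_peak 1) by rewrite divr_gt0.
have [Q Q0 approx] := normal_approx x c1 d0.
near=> n.
have [n2 hq] : (2 <= n)%N /\ (n%:R * p n ^+ 2)^-1 <= Q.
  by near: n; exact: sparse_near.
have pnc : p n <= c by near: n.
have := approx n (p n) n2 (hp n n2) pnc hq.
by rewrite mulrC divfK ?gt_eqF // distrC.
Unshelve. all: by end_near. Qed.
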